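(* Let $X=(X_1,X_2,\ldots)\in\mathcal{L}$ with $\nu$, $\theta$, $K$ as in the definition of $\mathcal{L}$, and let $\mu$ be a random probability measure on $(S,\mathcal{B})$ such that, for each fixed $A\in\mathcal{B}$, $$\mu(A)\overset{a.s.}=\lim_n\frac1n\sum_{i=1}^n1_A(X_i)\overset{a.s.}=\lim_nP\bigl(X_{n+1}\in A\mid\mathcal{F}_n\bigr).$$ Let $\mu^*=\sum_jV_j\,K(Z_j)$, where $(Z_j)_{j\ge1}$ and $(V_j)_{j\ge1}$ are independent sequences, $(Z_j)$ is i.i.d. with $Z_1\sim\nu$, and $(V_j)$ has the stick-breaking distribution with parameter $\theta$. Then $$P(\mu\in C)=P(\mu^*\in C)\quad\text{for all }C\in\mathcal{C}.$$
   Context: $S$ is a Borel subset of a Polish space and $\mathcal{B}$ is its Borel $\sigma$-field. All random elements are defined on a probability space $(\Omega,\mathcal{A},P)$, and $\mathcal{F}_n=\sigma(X_1,\ldots,X_n)$. $\mathcal{P}$ is the set of all probability measures on $\mathcal{B}$, and $\mathcal{C}$ is the $\sigma$-field on $\mathcal{P}$ generated by the maps $p\mapsto p(A)$, $A\in\mathcal{B}$. A kernel on $(S,\mathcal{B})$ is a measurable map $K:(S,\mathcal{B})\to(\mathcal{P},\mathcal{C})$; $K(x)(A)$ is the value of $K(x)$ at $A$. A random probability measure on $(S,\mathcal{B})$ is a measurable map $(\Omega,\mathcal{A})\to(\mathcal{P},\mathcal{C})$. $K$ is a regular conditional distribution for $\nu\in\mathcal{P}$ given a sub-$\sigma$-field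 $\mathcal{G}\subset\mathcal{B}$ if $K(x)\in\mathcal{P}$ for each $x\in S$, $x\mapsto K(x)(A)$ is $\mathcal{G}$-measurable for each $A\in\mathcal{B}$, and $\nu(A\cap G)=\int_GK(x)(A)\,\nu(dx)$ for all $A\in\mathcal{B}$, $G\in\mathcal{G}$. $\mathcal{L}$ is the class of all sequences $X=(X_1,X_2,\ldots)$ of $S$-valued random variables for which there are $\nu\in\mathcal{P}$, a constant $\theta>0$ and a kernel $K$ which is a regular conditional distribution for $\nu$ given some sub-$\sigma$-field $\mathcal{G}\subset\mathcal{B}$, such that $X_1\sim\nu$ and $P(X_{n+1}\in\cdot\mid\mathcal{F}_n)=\frac{\theta\nu(\cdot)+\sum_{i=1}^nK(X_i)(\cdot)}{n+\theta}$ a.s. for all $n\ge1$. Each $X\in\mathcal{L}$ is exchangeable, so a random probability measure $\mu$ as in the claim exists. A sequence $(V_n)$ has the stick-breaking distribution with parameter $\theta>0$ if it is distributed as $(T_n)$, where $T_1=W_1$, $T_n=W_n\prod_{i=1}^{n-1}(1-W_i)$ for $n>1$, and $(W_n)$ is i.i.d. with $W_1\sim\mathrm{beta}(1,\theta)$. *)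

(* Defs.v *)
From HB Require Import structures.
From mathcomp Require Import all_boot all_order all_algebra.
From mathcomp Require Import all_classical all_reals all_analysis.
From mathcomp Require Import measurable_realfun.

Set Implicit Arguments.
Unset Strict Implicit.
Unset Printing Implicit Defensive.

Import Order.TTheory GRing.Theory Num.Theory.
Import numFieldNormedType.Exports.

Local Open Scope classical_set_scope.
Local Open Scope ring_scope.

(* Sequences are indexed from 0: [X n] stands for the term of rank n + 1.
   The sigma-field generated by the maps p |-> p A is the one carried by
   [pprobability S R]: its generators are the sets {p | p A < r}.  As measures
   are total functions on [set S], laws are compared on measurable sets only. *)

Definition separable (E : topologicalType) : Prop :=
  exists2 D : set E, countable D & dense D.

Definition complete_metric (R : realType) (E : metricType R) : Prop :=
  forall F : set_system E, ProperFilter F -> cauchy F ->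
    exists l : E, F --> l.

(* The injection [iota] identifies S with a Borel subset of the Polish space E,
   and the sigma-field of S with the trace of the Borel sigma-field of E.
   As every [measurableType] is pointed, S is nonempty; this loses nothing,
   since S is to carry a probability measure. *)
Definition borel_subset_of_polish (R : realType) (d : measure_display)
    (S : measurableType d) : Prop :=
  exists (E : metricType R) (iota : S -> E),
    [/\ separable E, complete_metric E, injective iota,
        <<s (open : set (set E)) >> (range iota) &
        (measurable : set (set S)) =
          preimage_set_system setT iota <<s (open : set (set E)) >>].

Definition sigma_fam (I T : Type) (d' : measure_display)
    (T' : measurableType d') (D : set I) (Y : I -> T -> T') : set (set T) :=
  <<s \bigcup_(i in D) preimage_set_system setT (Y i) measurable >>.

Section conditional.
Context (R : realType) (d : measure_display) (T : measurableType d).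
Local Open Scope ereal_scope.

Definition sub_sigma_field (G : set (set T)) : Prop :=
  sigma_algebra setT G /\ G `<=` measurable.

Definition sub_measurable (G : set (set T)) (f : T -> \bar R) : Prop :=
  measurable_fun setT (f : g_sigma_algebraType G -> \bar R).

Definition cond_prob_version (P : probability T R) (G : set (set T))
    (E : set T) (f : T -> \bar R) : Prop :=
  sub_measurable G f /\
  forall B, G B -> P (E `&` B) = \int[P]_(x in B) f x.

Definition regular_cond_distribution (nu : probability T R) (G : set (set T))
    (K : T -> pprobability T R) : Prop :=
  (forall A, measurable A -> sub_measurable G (fun x => K x A)) /\
  (forall A B, measurable A -> G B -> nu (A `&` B) = \int[nu]_(x in B) K x A).

End conditional.

Section independence.
Context (R : realType) (d : measure_display) (T : measurableType d)
  (P : probability T R).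
Local Open Scope ereal_scope.

Definition indep_sigma (F G : set (set T)) : Prop :=
  forall A B, F A -> G B -> P (A `&` B) = P A * P B.

Definition mutually_indep (d' : measure_display) (T' : measurableType d')
    (Y : nat -> {RV P >-> T'}) : Prop :=
  forall (s : seq nat) (A : nat -> set T'), uniq s ->
    (forall j, measurable (A j)) ->
    P (\big[setI/setT]_(j <- s) (Y j @^-1` A j)) =
    \prod_(j <- s) P (Y j @^-1` A j).

Definition iid (d' : measure_display) (T' : measurableType d')
    (Y : nat -> {RV P >-> T'}) : Prop :=
  mutually_indep Y /\
  (forall j A, measurable A -> P (Y j @^-1` A) = P (Y 0%N @^-1` A)).

Definition indep_seq (d1 d2 : measure_display) (T1 : measurableType d1)
    (T2 : measurableType d2) (Y : nat -> {RV P >-> T1})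
    (Z : nat -> {RV P >-> T2}) : Prop :=
  indep_sigma (sigma_fam setT Y) (sigma_fam setT Z).

End independence.

(* Beta law with real parameters; the [beta_prob] of the library is restricted
   to natural ones. *)
Section beta.
Context (R : realType).
Local Notation mu := (@lebesgue_measure R).

Definition beta_weight (a b x : R) : R := x `^ (a - 1) * (1 - x) `^ (b - 1).

Definition real_beta_fun (a b : R) : R :=
  \int[mu]_(x in `]0%R, 1%R[) beta_weight a b x.

Definition real_beta_pdf (a b x : R) : R :=
  beta_weight a b x / real_beta_fun a b.

Definition beta_distributed (d : measure_display) (T : measurableType d)
    (P : probability T R) (a b : R) (W : {RV P >-> R}) : Prop :=
  forall A : set R, measurable A ->
    (P (W @^-1` A) = \int[mu]_(x in A `&` `]0%R, 1%R[) (real_beta_pdf a b x)%:E)%E.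

End beta.

Section stick_breaking.
Context (R : realType).

(* Equality of laws on R^nat with its product sigma-field. *)
Definition same_seq_law (d1 d2 : measure_display)
    (T1 : measurableType d1) (P1 : probability T1 R)
    (T2 : measurableType d2) (P2 : probability T2 R)
    (Y1 : nat -> T1 -> R) (Y2 : nat -> T2 -> R) : Prop :=
  forall B : set (nat -> R), sigma_fam setT (fun (j : nat) x => x j) B ->
    P1 [set w | B (Y1 ^~ w)] = P2 [set w | B (Y2 ^~ w)].

Definition sticks (T : Type) (W : nat -> T -> R) (n : nat) (w : T) : R :=
  W n w * \prod_(i < n) (1 - W i w).

Definition stick_breaking (d : measure_display) (T : measurableType d)
    (P : probability T R) (theta : R) (V : nat -> {RV P >-> R}) : Prop :=
  exists (d' : measure_display) (T' : measurableType d')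
    (P' : probability T' R) (W : nat -> {RV P' >-> R}),
    [/\ iid W, beta_distributed 1 theta (W 0%N) &
        same_seq_law P P' V (sticks W)].

End stick_breaking.

Section class_L.
Context (R : realType) (dO dS : measure_display) (Omega : measurableType dO)
  (S : measurableType dS) (P : probability Omega R).
Local Open Scope ereal_scope.

Definition past (X : nat -> {RV P >-> S}) (n : nat) : set (set Omega) :=
  sigma_fam `I_n X.

Definition predictive (nu : probability S R) (theta : R)
    (K : S -> pprobability S R) (X : nat -> {RV P >-> S}) (n : nat)
    (A : set S) (w : Omega) : \bar R :=
  (theta%:E * nu A + \sum_(i < n) K (X i w) A) * ((n%:R + theta)^-1)%:E.

Definition class_L (X : nat -> {RV P >-> S}) (nu : probability S R)
    (theta : R) (K : {mfun S >-> pprobability S R}) : Prop :=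
  [/\ (0 < theta)%R,
      exists2 G : set (set S),
        sub_sigma_field G & regular_cond_distribution nu G K,
      (forall A, measurable A -> P (X 0%N @^-1` A) = nu A) &
      (forall n A, (0 < n)%N -> measurable A ->
        cond_prob_version P (past X n) (X n @^-1` A)
          (predictive nu theta K X n A))].

Definition empirical_limit (X : nat -> {RV P >-> S})
    (mu : Omega -> pprobability S R) : Prop :=
  forall A, measurable A ->
    {ae P, forall w,
      (n%:R^-1 * \sum_(i < n) \1_A (X i w))%R%:E @[n --> \oo] --> mu w A}.

(* Conditional probabilities being defined up to null sets, any choice of
   versions is allowed. *)
Definition predictive_limit (X : nat -> {RV P >-> S})
    (mu : Omega -> pprobability S R) : Prop :=
  forall A, measurable A -> forall g : nat -> Omega -> \bar R,
    (forall n, (0 < n)%N ->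
      cond_prob_version P (past X n) (X n @^-1` A) (g n)) ->
    {ae P, forall w, g n w @[n --> \oo] --> mu w A}.

(* The weights sum to 1 only almost surely, hence so does the equality. *)
Definition stick_mixture (V : nat -> {RV P >-> R}) (Z : nat -> {RV P >-> S})
    (K : S -> pprobability S R) (mustar : Omega -> pprobability S R) : Prop :=
  {ae P, forall w, forall A, measurable A ->
    mustar w A = \sum_(0 <= j <oo) (V j w)%:E * K (Z j w) A}.

End class_L.

(* Main.v *)
Require Import Defs.
From mathcomp Require Import all_boot all_order all_algebra.
From mathcomp Require Import all_classical all_reals all_analysis.
From mathcomp Require Import measurable_realfun.
From mathcomp Require Import ring lra zify.

Set Implicit Arguments.
Unset Strict Implicit.
Unset Printing Implicit Defensive.

Import Order.TTheory GRing.Theory Num.Theory.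
Import numFieldNormedType.Exports.

Local Open Scope classical_set_scope.
Local Open Scope ring_scope.

(* Both laws are determined by the moments E[p(f)^m], where f = sum_j t_j 1_{A_j}
   and p(f) = sum_j t_j p(A_j): these give the mixed moments of (p(A_1), ...,
   p(A_k)), and indicators of half-lines are pointwise limits of polynomials
   on [0, 1].

   Put g x = K(x)(f), which is G-measurable, and kappa_k = nu(g^k).  As K(x)(A)
   is 1_A(x) for nu-almost all x when A is in G, the variables g(X_i) form a
   Polya urn: E[U h(X_{n+1})] = (theta nu(h) E[U] + sum_{i <= n} E[U h(X_i)]) /
   (n + theta) for U depending on the past and h a power of g.  This recursion
   alone makes the moments of (g(X_1), ..., g(X_n)) symmetric, and mu(f) is the
   limit of the means of the g(X_i), so that M_m := E[mu(f)^m] equals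
   E[g(X_1) ... g(X_m)].

   On the other side mu*(f) = sum_j V_j g(Z_j), and splitting off the first stick
   gives N_m := E[mu*(f)^m] = sum_k C(m, k) kappa_k b(k, m - k) N_{m-k} with
   b(k, l) = E[W^k (1 - W)^l], W ~ beta(1, theta).  As b(0, m) < 1 for m > 0,
   this determines (N_m), and the urn recursion shows that (M_m) satisfies it. *)

(** * Bounded measurable functions and their expectations *)

(** Three obstacles shape the proof. The relation between K(x)(A) and 1_A(x) holds off a null set
    that depends on A; it is therefore integrated for one set at a time, and the resulting
    identities are extended to bounded functions, both sides being linear and continuous for the sup
    norm. On the urn side mu(f) is only a limit: its powers are treated one factor at a time, a
    factor being replaced by averages whose terms of large index all have the same integral, by
    symmetry. On the stick side no rescaled independent copy of the remaining sticks is built: the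
    recursion is exact for finitely many sticks, the powers of 1 - W being recorded as exponents,
    and it then passes to the limit. The two recursions meet after multiplication by rising
    factorials of theta: a binomial coefficient C(m, k) times the k! of the beta moment is a falling
    factorial, which on the urn side counts the successive choices of variables that merge. *)

Section bounded_measurable.
Context (R : realType) (d : measure_display) (T : measurableType d).
Implicit Types (f g : T -> R).

Definition bmeas f :=
  measurable_fun setT f /\ exists M : R, forall x, `|f x| <= M.

Lemma bmeasP f : bmeas f -> exists2 M : R, 0 < M & forall x, `|f x| <= M.
Proof.
move=> [_ [M fM]]; exists (Num.max M 1); first by rewrite lt_max ltr01 orbT.
by move=> x; rewrite le_max fM.
Qed.

Lemma bmeas_cst (c : R) : bmeas (fun=> c).
Proof. by split; [exact: measurable_cst|exists `|c|]. Qed.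

Lemma bmeasD f g : bmeas f -> bmeas g -> bmeas (fun x => f x + g x).
Proof.
move=> [mf [M fM]] [mg [N gN]]; split; first exact: measurable_funD.
by exists (M + N) => x; rewrite (le_trans (ler_normD _ _))// lerD.
Qed.

Lemma bmeasM f g : bmeas f -> bmeas g -> bmeas (fun x => f x * g x).
Proof.
move=> [mf [M fM]] [mg [N gN]]; split; first exact: measurable_funM.
by exists (M * N) => x; rewrite normrM ler_pM.
Qed.

Lemma bmeasZ (c : R) f : bmeas f -> bmeas (fun x => c * f x).
Proof. by apply: bmeasM; exact: bmeas_cst. Qed.

Lemma bmeasN f : bmeas f -> bmeas (fun x => - f x).
Proof.
by move=> bf; rewrite (_ : (fun _ => _) = (fun x => -1 * f x));
  [exact: bmeasZ|apply/funext => x; rewrite mulN1r].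
Qed.

Lemma bmeasB f g : bmeas f -> bmeas g -> bmeas (fun x => f x - g x).
Proof. by move=> bf /bmeasN; exact: bmeasD. Qed.

Lemma bmeasX f n : bmeas f -> bmeas (fun x => f x ^+ n).
Proof.
move=> bf; elim: n => [|n IHn].
  by under eq_fun do rewrite expr0; exact: bmeas_cst.
by under eq_fun do rewrite exprS; exact: bmeasM.
Qed.

Lemma bmeas_sum I (s : seq I) (F : I -> T -> R) :
  (forall i, bmeas (F i)) -> bmeas (fun x => \sum_(i <- s) F i x).
Proof.
move=> bF; elim: s => [|i s IHs].
  by under eq_fun do rewrite big_nil; exact: bmeas_cst.
by under eq_fun do rewrite big_cons; exact: bmeasD.
Qed.

Lemma bmeas_prod I (s : seq I) (F : I -> T -> R) :
  (forall i, bmeas (F i)) -> bmeas (fun x => \prod_(i <- s) F i x).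
Proof.
move=> bF; elim: s => [|i s IHs].
  by under eq_fun do rewrite big_nil; exact: bmeas_cst.
by under eq_fun do rewrite big_cons; exact: bmeasM.
Qed.

Lemma bmeas_indic (A : set T) : measurable A -> bmeas (\1_A : T -> R).
Proof.
move=> mA; split; first exact: measurable_indic.
by exists 1 => x; rewrite indicE; case: (_ \in _); rewrite ?normr1 ?normr0.
Qed.

(** Continuity for the sup norm takes the place of monotone convergence: simple functions are
    uniformly dense among the bounded measurable ones, so indicators determine such a functional. *)
Definition bounded_linear (L : (T -> R) -> R) :=
  (forall a f g, bmeas f -> bmeas g ->
     L (fun x => a * f x + g x) = a * L f + L g) /\
  exists C, forall f M, bmeas f -> (forall x, `|f x| <= M) -> `|L f| <= C * M.

(* Binary expansion: [f = (1_A + f') / 2] with [A = {f >= 1/2}] and [f'] again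
   [0, 1]-valued, so the norm of [L] on such functions is at most half itself. *)
Lemma bounded_linear_eq0 (L : (T -> R) -> R) : bounded_linear L ->
  (forall A, measurable A -> L \1_A = 0) -> forall f, bmeas f -> L f = 0.
Proof.
move=> [Llin [C LC]] L0.
have L1 c : L (fun=> c) = 0.
  have -> : (fun=> c) = (fun x => c * \1_setT x + (\1_set0 : T -> R) x).
    by apply/funext => x; rewrite !indicE in_setT in_set0 mulr1 addr0.
  by rewrite Llin ?L0 ?mulr0 ?addr0//; exact: bmeas_indic.
have C0 : 0 <= C.
  have z1 (x : T) : `|(0 : R)| <= 1 by rewrite normr0.
  by have := LC _ _ (bmeas_cst 0) z1; rewrite L1 normr0 mulr1.
have half n f : bmeas f -> (forall x, 0 <= f x <= 1) -> `|L f| <= C * 2^-1 ^+ n.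
  elim: n f => [|n IHn] f bf f01.
    by rewrite expr0; apply: LC => // x; case/andP: (f01 x) => f0 f1; rewrite ger0_norm.
  pose A := [set x | 2^-1 <= f x].
  have mA : measurable A.
    rewrite -[A]setTI -[A]/(f @^-1` [set y | 2^-1 <= y]).
    apply: bf.1 => //.
    by rewrite -[X in measurable X]/([set y | 2^-1 <= y]) -set_itvcy; exact: measurable_itv.
  pose g := fun x => 2 * f x + -1 * \1_A x.
  have bg : bmeas g by apply: bmeasD; apply: bmeasZ => //; exact: bmeas_indic.
  have g01 x : 0 <= g x <= 1.
    rewrite /g indicE; case/andP: (f01 x) => f0 f1.
    have [/set_mem h|xA] := boolP (x \in A).
      by move: h; rewrite /A/= mulr1 => h; apply/andP; split; lra.
    have fx : f x < 2^-1 by rewrite ltNge; apply: contra xA => ?; rewrite inE.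
    rewrite mulr0.
    by apply/andP; split; lra.
  have -> : L f = 2^-1 * L g.
    rewrite (_ : f = fun x => 2^-1 * g x + 2^-1 * \1_A x); last first.
      by apply/funext => x; rewrite /g; field.
    have bA := bmeas_indic mA.
    rewrite (Llin _ _ _ bg (bmeasZ 2^-1 bA)).
    rewrite (_ : (fun x => _ * \1_A x) = fun x => 2^-1 * \1_A x + (fun=> 0) x); last first.
      by apply/funext => x; rewrite addr0.
    by rewrite (Llin _ _ _ bA (bmeas_cst 0)) L0// L1 mulr0 !addr0.
  rewrite normrM exprS mulrCA ger0_norm//.
  by rewrite ler_pM2l// IHn.
have L01 f : bmeas f -> (forall x, 0 <= f x <= 1) -> L f = 0.
  move=> bf f01; apply/eqP; rewrite -normr_eq0 eq_le normr_ge0 andbT.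
  have cvg0 : C * 2^-1 ^+ n @[n --> \oo] --> C * 0.
    by apply: cvgMr; apply: cvg_expr; rewrite ger0_norm// invf_lt1// ltr1n.
  rewrite -(mulr0 C) -(cvg_lim _ cvg0)//; apply: limr_ge.
    by apply/cvg_ex; eexists; exact: cvg0.
  by near=> n; exact: half.
move=> f bf; have [M M0 fM] := bmeasP bf.
pose g := fun x => (2 * M)^-1 * f x + 2^-1.
have bg : bmeas g by apply: bmeasD; [exact: bmeasZ|exact: bmeas_cst].
have -> : f = fun x => (2 * M) * g x + (fun=> - M) x.
  by apply/funext => x; rewrite /g; field; rewrite gt_eqF.
rewrite (Llin _ _ _ bg (bmeas_cst _)) L1 addr0 L01 ?mulr0//.
move=> x; have := fM x; rewrite ler_norml => /andP[h1 h2].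
rewrite /g (_ : _ + _ = (f x + M) / (2 * M)); last by field; rewrite gt_eqF.
rewrite divr_ge0 ?ler_pdivrMr ?mulr_gt0//=; lra.
Unshelve. all: by end_near. Qed.

End bounded_measurable.

Lemma cvg_sumr (R : realType) (I : eqType) (s : seq I) (u : I -> nat -> R) (l : I -> R) :
  (forall i, i \in s -> u i n @[n --> \oo] --> l i) ->
  \sum_(i <- s) u i n @[n --> \oo] --> \sum_(i <- s) l i.
Proof.
elim: s => [|i s IHs] ul.
  by rewrite big_nil; under eq_cvg do rewrite big_nil; exact: cvg_cst.
rewrite big_cons; under eq_cvg do rewrite big_cons.
apply: cvgD; first by apply: ul; rewrite mem_head.
by apply: IHs => j js; apply: ul; rewrite in_cons js orbT.
Qed.

Section bounded_linear_functionals.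
Context (R : realType) (d : measure_display) (T : measurableType d).
Implicit Types (L : (T -> R) -> R).

Lemma bounded_linear0 : @bounded_linear R d T (fun=> 0).
Proof.
split; first by move=> a f g _ _; rewrite mulr0 addr0.
by exists 0 => f M _ _; rewrite normr0 mul0r.
Qed.

Lemma bounded_linearD L1 L2 : bounded_linear L1 -> bounded_linear L2 ->
  bounded_linear (fun f => L1 f + L2 f).
Proof.
move=> [l1 [C1 b1]] [l2 [C2 b2]]; split.
  by move=> a f g bf bg; rewrite l1// l2//; ring.
exists (C1 + C2) => f M bf fM; rewrite (le_trans (ler_normD _ _))// mulrDl.
by rewrite lerD// ?b1 ?b2.
Qed.

Lemma bounded_linearZ c L : bounded_linear L -> bounded_linear (fun f => c * L f).
Proof.
move=> [l [C b]]; split.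
  by move=> a f g bf bg; rewrite l//; ring.
by exists (`|c| * C) => f M bf fM; rewrite normrM -mulrA ler_wpM2l// b.
Qed.

Lemma bounded_linear_sum I (s : seq I) (L : I -> (T -> R) -> R) :
  (forall i, bounded_linear (L i)) -> bounded_linear (fun f => \sum_(i <- s) L i f).
Proof.
move=> bL; elim: s => [|i s IHs].
  by under eq_fun do rewrite big_nil; exact: bounded_linear0.
by under eq_fun do rewrite big_cons; exact: bounded_linearD.
Qed.

(** The difference vanishes on indicators. Through this lemma, identities between expectations are
    reduced to events, one variable at a time. *)
Lemma bounded_linear_eq L1 L2 : bounded_linear L1 -> bounded_linear L2 ->
  (forall A, measurable A -> L1 \1_A = L2 \1_A) ->
  forall f, bmeas f -> L1 f = L2 f.
Proof.
move=> b1 b2 L12 f bf; apply/eqP; rewrite -subr_eq0 -mulN1r; apply/eqP.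
apply: (bounded_linear_eq0 (bounded_linearD b1 (bounded_linearZ (-1) b2))) => //.
by move=> A mA; rewrite L12// mulN1r subrr.
Qed.

End bounded_linear_functionals.

Lemma bmeas_comp (R : realType) (d d' : measure_display) (T : measurableType d)
    (T' : measurableType d') (f : T' -> R) (Y : T -> T') :
  measurable_fun setT Y -> bmeas f -> bmeas (fun x => f (Y x)).
Proof.
move=> mY [mf [M fM]]; split; last by exists M => x.
exact: (measurableT_comp mf mY).
Qed.

Section expectation.
Context (R : realType) (d : measure_display) (T : measurableType d)
  (P : probability T R).
Implicit Types (f g : T -> R).

Definition expect f : R := \int[P]_x f x.

Lemma bmeas_integrable f : bmeas f -> P.-integrable setT (EFin \o f).
Proof.
move=> bf; have [M M0 fM] := bmeasP bf.
apply: measurable_bounded_integrable => //.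
- by rewrite -ge0_fin_numE// fin_num_measure.
- exact: bf.1.
by exists M; split; rewrite ?num_real// => N MN x _; rewrite /= (le_trans (fM x))// ltW.
Qed.

Lemma expect_linear a f g : bmeas f -> bmeas g ->
  expect (fun x => a * f x + g x) = a * expect f + expect g.
Proof.
move=> bf bg; rewrite /expect RintegralD ?RintegralZl//.
- exact: bmeas_integrable.
- by apply: (@bmeas_integrable (fun x => a * f x)); exact: bmeasZ.
- exact: bmeas_integrable.
Qed.

Lemma expect_cst c : expect (fun=> c) = c.
Proof.
have := @Rintegral_cst _ _ _ P setT measurableT c.
by rewrite [X in fine X](_ : _ = 1%E) /= ?mulr1//; exact: probability_setT.
Qed.

Lemma expect_indic A : measurable A -> expect \1_A = fine (P A).
Proof.
by move=> mA; rewrite /expect /Rintegral integral_indic// setIT.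
Qed.

Lemma expectD f g : bmeas f -> bmeas g ->
  expect (fun x => f x + g x) = expect f + expect g.
Proof.
by move=> bf bg; rewrite -[X in X + _]mul1r -expect_linear//; under [in RHS]eq_fun do rewrite mul1r.
Qed.

Lemma expectZ a f : bmeas f -> expect (fun x => a * f x) = a * expect f.
Proof.
move=> bf; have := expect_linear a bf (bmeas_cst T 0); rewrite expect_cst addr0 => <-.
by under [in RHS]eq_fun do rewrite addr0.
Qed.

Lemma expectB f g : bmeas f -> bmeas g ->
  expect (fun x => f x - g x) = expect f - expect g.
Proof.
move=> bf bg; rewrite expectD//; last exact: bmeasN.
by congr (_ + _); rewrite -mulN1r -expectZ//; under [in RHS]eq_fun do rewrite mulN1r.
Qed.

Lemma expect_sum I (s : seq I) (F : I -> T -> R) : (forall i, bmeas (F i)) ->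
  expect (fun x => \sum_(i <- s) F i x) = \sum_(i <- s) expect (F i).
Proof.
move=> bF; elim: s => [|i s IHs].
  by under eq_fun do rewrite big_nil; rewrite big_nil expect_cst.
under eq_fun do rewrite big_cons.
by rewrite big_cons expectD ?IHs//; exact: bmeas_sum.
Qed.

Lemma expect_ge0 f : (forall x, 0 <= f x) -> 0 <= expect f.
Proof. by move=> f0; apply: Rintegral_ge0. Qed.

Lemma ler_expect f g : bmeas f -> bmeas g -> (forall x, f x <= g x) ->
  expect f <= expect g.
Proof.
move=> bf bg fg; rewrite -subr_ge0 -expectB// expect_ge0// => x.
by rewrite subr_ge0.
Qed.

Lemma expect_normr_le f M : bmeas f -> (forall x, `|f x| <= M) -> `|expect f| <= M.
Proof.
move=> bf fM; rewrite ler_norml; apply/andP; split.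
  rewrite -[X in X <= _]expect_cst; apply: ler_expect => //; first exact: bmeas_cst.
  by move=> x; have := fM x; rewrite ler_norml => /andP[].
rewrite -[X in _ <= X]expect_cst; apply: ler_expect => //; first exact: bmeas_cst.
by move=> x; have := fM x; rewrite ler_norml => /andP[].
Qed.

Lemma expect_ae_eq f g : bmeas f -> bmeas g ->
  {ae P, forall x, f x = g x} -> expect f = expect g.
Proof.
move=> bf bg fg; congr fine; apply: ae_eq_integral => //.
- exact/measurable_EFinP/bf.1.
- exact/measurable_EFinP/bg.1.
- by apply: filterS fg => x /= ->.
Qed.

Lemma expect_dominated (F : nat -> T -> R) f M : (forall n, bmeas (F n)) -> bmeas f ->
  (forall n, {ae P, forall x, `|F n x| <= M}) ->
  {ae P, forall x, F n x @[n --> \oo] --> f x} ->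
  expect (F n) @[n --> \oo] --> expect f.
Proof.
move=> bF bf FM Ff.
have := @dominated_convergence _ _ _ P setT measurableT
  (fun n x => (F n x)%:E) (fun x => (f x)%:E) (fun=> M%:E).
case.
- by move=> n; exact/measurable_EFinP/(bF n).1.
- exact/measurable_EFinP/bf.1.
- by apply: filterS Ff => x /= Fx _; apply: cvg_EFin => //; exact: nearW.
- by apply: (@bmeas_integrable (fun=> M)); exact: bmeas_cst.
- have : {ae P, forall x, forall n, `|F n x| <= M} by exact/ae_foralln.
  by apply: filterS => x Fx n _ /=; rewrite lee_fin.
move=> _ _ h; rewrite /expect /Rintegral; apply: fine_cvg.
rewrite fineK//; apply: integrable_fin_num => //.
exact: (bmeas_integrable bf).
Qed.

Lemma bounded_linear_expect (d' : measure_display) (T' : measurableType d')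
    (Y : T -> T') (U : T -> R) : measurable_fun setT Y -> bmeas U ->
  bounded_linear (fun f : T' -> R => expect (fun x => U x * f (Y x))).
Proof.
move=> mY bU; have bUc (f : T' -> R) : bmeas f -> bmeas (fun x => U x * f (Y x)).
  by move=> bf; apply: bmeasM => //; exact: bmeas_comp.
split=> [a f g bf bg|].
  rewrite -expect_linear//; [|exact: bUc..].
  by congr expect; apply/funext => x; ring.
have [M M0 UM] := bmeasP bU.
exists M => f N bf fN; apply: expect_normr_le; first exact: bUc.
by move=> x; rewrite normrM ler_pM.
Qed.

Lemma bounded_linear_expect1 (d' : measure_display) (T' : measurableType d')
    (Y : T -> T') : measurable_fun setT Y ->
  bounded_linear (fun f : T' -> R => expect (fun x => f (Y x))).
Proof.
move=> mY; have := bounded_linear_expect mY (bmeas_cst T 1).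
rewrite (_ : (fun f : T' -> R => expect (fun x => 1 * f (Y x))) =
  fun f : T' -> R => expect (fun x => f (Y x)))//.
by apply/funext => f; congr expect; apply/funext => x; rewrite mul1r.
Qed.

End expectation.

(** * Moments of an urn *)

(** When a new variable copies an earlier one, its exponent [e] merges into the exponent of that
    variable; this is the list that results. *)
Definition add_at (L : seq nat) (i e : nat) : seq nat :=
  take i L ++ (nth 0%N L i + e)%N :: drop i.+1 L.

Lemma size_add_at L i e : (i < size L)%N -> size (add_at L i e) = size L.
Proof.
by move=> iL; rewrite size_cat /= size_takel ?(ltnW iL)// size_drop addnS -addSn subnKC.
Qed.

Lemma nth_add_at L i e j : (i < size L)%N ->
  nth 0%N (add_at L i e) j = (nth 0 L j + (j == i) * e)%N.
Proof.
move=> iL; rewrite nth_cat size_takel ?(ltnW iL)//.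
have [ji|ij|->] := ltngtP j i.
- by rewrite nth_take// addn0.
- have -> : (j - i = (j - i.+1).+1)%N by rewrite subnSK.
  by rewrite /= nth_drop subnKC// addn0.
- by rewrite subnn /= mul1n.
Qed.

Lemma add_atC L i j e e' : (i < size L)%N -> (j < size L)%N ->
  add_at (add_at L i e) j e' = add_at (add_at L j e') i e.
Proof.
move=> iL jL; apply: (@eq_from_nth _ 0%N); first by do !rewrite size_add_at//.
move=> k _; do !rewrite nth_add_at ?size_add_at//.
by rewrite addnAC.
Qed.

(** Up to order, the outcome of a merge depends on the value found at position [i] and not on [i];
    sums over positions thus become sums over the multiset of exponents. *)
Lemma perm_add_at L i e : (i < size L)%N ->
  perm_eq (add_at L i e) ((nth 0%N L i + e)%N :: rem (nth 0%N L i) L).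
Proof.
move=> iL; rewrite /add_at perm_catC /= perm_cons perm_catC.
rewrite -(perm_cons (nth 0%N L i)) -(permPr (perm_to_rem (mem_nth _ iL))).
rewrite -[X in perm_eq _ X](cat_take_drop i) (drop_nth 0%N iL).
by rewrite -(cat1s _ (drop _ _)) perm_sym perm_catCA.
Qed.

Section urn_moments.
Context (R : realType) (theta : R) (kappa : nat -> R) (Phi : seq nat -> R).
Hypothesis theta0 : 0 < theta.
Hypothesis Phi0 : Phi [::] = 1.
Hypothesis PhiS : forall e L,
  ((size L)%:R + theta) * Phi (e :: L) =
  theta * kappa e * Phi L + \sum_(i < size L) Phi (add_at L i e).

Let theta_neq0 (n : nat) : n%:R + theta != 0.
Proof. by rewrite gt_eqF// ltr_wpDl. Qed.

(** Two applications of the recursion give the expansion [H], symmetric in [a] and [b]: both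
    exponents are fresh, one is fresh and the other merges into [L], they merge with each other, or
    both merge into [L]. The last case is symmetric by [add_atC]. *)
Let Phi_swap e e' L : Phi (e :: e' :: L) = Phi (e' :: e :: L).
Proof.
suff H a b : ((size L).+1%:R + theta) * ((size L)%:R + theta) * Phi (a :: b :: L) =
    theta * kappa a * (theta * kappa b) * Phi L +
    theta * kappa a * \sum_(i < size L) Phi (add_at L i b) +
    theta * kappa b * \sum_(i < size L) Phi (add_at L i a) +
    ((size L)%:R + theta) * Phi ((a + b)%N :: L) +
    \sum_(i < size L) \sum_(j < size L) Phi (add_at (add_at L i a) j b).
  apply: (mulfI (mulf_neq0 (theta_neq0 (size L).+1) (theta_neq0 (size L)))).
  rewrite !H [in RHS]exchange_big (addnC e').
  under [in RHS]eq_bigr do under eq_bigr do rewrite add_atC//.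
  by ring.
have E1 : ((size L).+1%:R + theta) * Phi (a :: b :: L) = theta * kappa a * Phi (b :: L) +
    (Phi ((a + b)%N :: L) + \sum_(i < size L) Phi (b :: add_at L i a)).
  by rewrite (PhiS a (b :: L)) /= big_ord_recl /add_at /= drop0 addnC.
have E2 : (\sum_(i < size L) Phi (b :: add_at L i a)) * ((size L)%:R + theta) =
    theta * kappa b * \sum_(i < size L) Phi (add_at L i a) +
    \sum_(i < size L) \sum_(j < size L) Phi (add_at (add_at L i a) j b).
  rewrite mulr_suml mulr_sumr -big_split; apply: eq_bigr => i _ /=.
  by have := PhiS b (add_at L i a); rewrite size_add_at// mulrC.
rewrite mulrAC E1 2!mulrDl -[_ * Phi (b :: L) * _]mulrA (mulrC (Phi (b :: L))).
by rewrite (PhiS b L) E2; ring.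
Qed.

(** Induction on the length. For equal heads, the recursion leads to shorter lists and, by
    [perm_add_at], sees the tail only as a multiset. For distinct heads, the head of [L'] is brought
    to the front of the tail of the other list and [Phi_swap] exchanges the two. *)
Lemma urn_moment_perm L L' : perm_eq L L' -> Phi L = Phi L'.
Proof.
have [n] := ubnP (size L); elim: n L L' => // n IHn [|a L] [|b L'] Ln LL'.
- by [].
- by have := perm_size LL'.
- by have := perm_size LL'.
have Phi_tail c M M' : (size M < n)%N -> perm_eq M M' -> Phi (c :: M) = Phi (c :: M').
  move=> Mn MM'.
  have rec N : (size N < n)%N -> ((size N)%:R + theta) * Phi (c :: N) =
      theta * kappa c * Phi N + \sum_(x <- N) Phi ((x + c)%N :: rem x N).
    move=> Nn; rewrite PhiS (big_nth 0%N) big_mkord; congr (_ + _).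
    apply: eq_bigr => i _; apply: IHn; first by rewrite size_add_at.
    exact: perm_add_at.
  have M'n : (size M' < n)%N by rewrite -(perm_size MM').
  apply: (mulfI (theta_neq0 (size M))).
  rewrite rec// [in RHS](perm_size MM') rec// (IHn _ _ _ MM')// (perm_big _ MM')/=.
  congr (_ + _); apply: eq_big_seq => x xM'.
  have xM : x \in M by rewrite (perm_mem MM').
  apply: IHn; first by rewrite /= size_rem// prednK//; case: (M) xM.
  by rewrite perm_cons -(perm_cons x) -(permPl (perm_to_rem xM)) -(permPr (perm_to_rem xM')).
have Ln' : (size L < n)%N by [].
have [ab|ab] := eqVneq a b.
  by rewrite -ab; apply: Phi_tail => //; move: LL'; rewrite ab perm_cons.
have bL : b \in L.
  have : b \in a :: L by rewrite (perm_mem LL') mem_head.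
  by rewrite in_cons eq_sym (negbTE ab).
have Lb := perm_to_rem bL.
rewrite (Phi_tail _ _ _ Ln' Lb) Phi_swap; apply: Phi_tail.
  by rewrite /= size_rem// prednK//; case: (L) bL.
rewrite -(perm_cons b) -(permPr LL') (perm_catCA [:: b] [:: a])/=.
by rewrite perm_cons perm_sym.
Qed.

(** The rising factorial of [theta], that is, the product of the denominators that [PhiS] produces
    over the first [n] draws. *)
Definition rising (n : nat) : R := \prod_(i < n) (theta + i%:R).

Lemma risingS n : rising n.+1 = rising n * (theta + n%:R).
Proof. by rewrite /rising big_ord_recr. Qed.

Lemma rising_neq0 n : rising n != 0.
Proof.
by apply/prodf_neq0 => i _; rewrite addrC theta_neq0.
Qed.

Let Psi n := rising n * Phi (nseq n 1%N).

(** By symmetry, the [n] ways in which the head can merge with an exponent 1 all give [a.+1]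
    followed by one 1 fewer. Iterating, the head absorbs [j] ones, in [n ^_ j] ways, before it
    counts as fresh. *)
Let Psi_cons a n : rising n.+1 * Phi (a :: nseq n 1%N) =
  \sum_(j < n.+1) theta * kappa (a + j)%N * (n ^_ j)%:R * Psi (n - j)%N.
Proof.
elim: n a => [|n IHn] a.
  rewrite big_ord1 risingS /rising /Psi big_ord0 /= addn0 ffactn0 mul1r mulr1.
  by rewrite addrC -[0%N]/(size (@nil nat)) PhiS big_ord0 addr0 /rising big_ord0 mul1r.
rewrite risingS -mulrA (addrC theta).
rewrite -[X in X%:R + theta](size_nseq n.+1 1%N) PhiS size_nseq.
rewrite [in RHS]big_ord_recl /= subn0 ffactn0 addn0 mulr1 mulrDr.
congr (_ + _); first by rewrite /Psi /=; ring.
rewrite (eq_bigr (fun=> Phi (a.+1 :: nseq n 1%N))); last first.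
  move=> i _; apply: urn_moment_perm.
  have iL : (i < size (nseq n.+1 1%N))%N by rewrite size_nseq.
  by rewrite (permPl (perm_add_at _ iL)) nth_nseq ltn_ord add1n perm_cons /=.
rewrite sumr_const card_ord -mulr_natl mulrCA IHn mulr_sumr; apply: eq_bigr => j _.
by rewrite /bump /= add1n addnS addSn subSS ffactnS natrM /=; ring.
Qed.

Lemma urn_moment_rec n : rising n.+1 * Phi (nseq n.+1 1%N) =
  \sum_(j < n.+1) theta * kappa j.+1 * (n ^_ j)%:R *
                  (rising (n - j) * Phi (nseq (n - j) 1%N)).
Proof. by rewrite -[nseq n.+1 1%N]/(1%N :: nseq n 1%N) Psi_cons. Qed.

(** This is theta B(k + 1, theta + l), the expectation of W^k (1 - W)^l for W ~ beta(1, theta), with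
    the quotient of Gamma values written as a finite product. *)
Definition beta_moment (k l : nat) : R :=
  theta * k`!%:R / \prod_(i < k.+1) (theta + (l + i)%:R).

(** The term [k = 0] contains [N m] itself, with coefficient theta / (theta + m). Moved to the left
    it leaves the factor m / (theta + m), nonzero for m > 0; multiplied by [rising m.+1], the rest
    is m times the right-hand side of [urn_moment_rec]. *)
Lemma stick_recursion_unique (N : nat -> R) : kappa 0%N = 1 -> N 0%N = 1 ->
  (forall m, N m = \sum_(k < m.+1) 'C(m, k)%:R * kappa k * beta_moment k (m - k) * N (m - k)%N) ->
  forall m, N m = Phi (nseq m 1%N).
Proof.
move=> k0 N0 Nrec m; have [n] := ubnP m; elim: n m => // n IHn [|m] mn.
  by rewrite N0 Phi0.
have := Nrec m.+1; rewrite big_ord_recl /= bin0 k0 !mul1r subn0.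
rewrite /beta_moment fact0 mulr1 big_ord1 addn0.
move=> H.
have : rising m.+2 * N m.+1 * (m.+1%:R / (theta + m.+1%:R)) =
    m.+1%:R * (rising m.+1 * Phi (nseq m.+1 1%N)).
  transitivity (rising m.+2 * (N m.+1 - theta / (theta + m.+1%:R) * N m.+1)).
    have t0 : theta + m.+1%:R != 0 by rewrite addrC theta_neq0.
    have -> : m.+1%:R / (theta + m.+1%:R) = 1 - theta / (theta + m.+1%:R).
      by rewrite -[X in X - _](divff t0) -mulrBl addrAC subrr add0r.
    by ring.
  rewrite {1}H addrAC subrr add0r urn_moment_rec !mulr_sumr.
  apply: eq_bigr => j _; rewrite /bump /= add1n subSS.
  rewrite IHn; last by rewrite (leq_ltn_trans (leq_subr _ _)).
  have jm : (j <= m)%N by rewrite -ltnS.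
  (* The last [j.+2] factors are exactly the denominator of [beta_moment j.+1 (m - j)]. *)
  have -> : rising m.+2 = rising (m - j) * \prod_(i < j.+2) (theta + (m - j + i)%:R).
    rewrite /rising (_ : m.+2 = (m - j + j.+2)%N); last by rewrite !addnS subnK.
    by rewrite big_split_ord.
  have -> : m.+1%:R * (theta * kappa j.+1 * (m ^_ j)%:R * (rising (m - j) * Phi (nseq (m - j) 1%N)))
      = (m.+1 ^_ j.+1)%:R * theta * kappa j.+1 * (rising (m - j) * Phi (nseq (m - j) 1%N)).
    by rewrite ffactnS natrM /=; ring.
  rewrite -bin_ffact natrM.
  field.
  by apply/prodf_neq0 => i _; rewrite addrC theta_neq0.
have m0 : m.+1%:R != 0 :> R by rewrite pnatr_eq0.
have t0 : theta + m.+1%:R != 0 by rewrite addrC theta_neq0.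
rewrite (risingS m.+1) => H2; apply: (mulfI (rising_neq0 m.+1)); apply: (mulfI m0).
rewrite -H2; move: (m.+1%:R) t0 {H2 m0} => y t0; by field.
Qed.

End urn_moments.

Lemma cvg_affine_ratio (R : realType) (a b t : R) : 0 < t ->
  (a + n%:R * b) / (n%:R + t) @[n --> \oo] --> b.
Proof.
move=> t0; have nt0 (n : nat) : 0 < n%:R + t by rewrite ltr_wpDl.
have cvgV : (n%:R + t)^-1 @[n --> \oo] --> (0 : R).
  apply/gtr0_cvgV0; first exact: nearW.
  apply/cvgryPge => A; have /cvgryPge/(_ A) := @cvgr_idn R.
  by apply: filterS => n An; rewrite (le_trans An)// lerDl ltW.
rewrite (_ : (fun _ => _) = fun n : nat => b + (a - t * b) * (n%:R + t)^-1); last first.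
  by apply/funext => n; field; rewrite gt_eqF.
rewrite -[X in _ --> X]addr0 -(mulr0 (a - t * b)).
by apply: cvgD; [exact: cvg_cst|exact: cvgMr].
Qed.

(** * Powers of the limiting mean of an urn *)

Section urn_limit.
Context (R : realType) (d : measure_display) (Omega : measurableType d)
  (P : probability Omega R) (Y : nat -> Omega -> R).

(* The exponents are listed from the last variable down to the first. *)
Fixpoint monomial (L : seq nat) (w : Omega) : R :=
  if L is e :: L' then Y (size L') w ^+ e * monomial L' w else 1.

Lemma monomial_add_at L i e w : (i < size L)%N ->
  monomial (add_at L i e) w = Y (size L - i.+1)%N w ^+ e * monomial L w.
Proof.
elim: L i => // a L IHL [|i] iL.
  by rewrite /add_at /= drop0 subSS subn0 exprD; ring.
rewrite (_ : add_at (a :: L) i.+1 e = a :: add_at L i e)//= size_add_at// IHL// subSS.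
by rewrite mulrCA.
Qed.

(** Zero exponents let a list reach a variable of any larger index without changing the monomial. *)
Lemma monomial_nseq0 n L w : monomial (nseq n 0%N ++ L) w = monomial L w.
Proof. by elim: n => //= n IHn; rewrite expr0 mul1r IHn. Qed.

Context (M : R).
Hypothesis mY : forall i, measurable_fun setT (Y i).
Hypothesis YM : forall i w, `|Y i w| <= M.

Let bY i : bmeas (Y i). Proof. by split=> //; exists M. Qed.

Lemma bmeas_monomial L : bmeas (monomial L).
Proof.
elim: L => [|e L IHL] /=; first exact: bmeas_cst.
by apply: bmeasM => //; exact: bmeasX.
Qed.

Context (theta : R) (kappa : nat -> R).
Hypothesis theta0 : 0 < theta.
Hypothesis urn : forall e L, ((size L)%:R + theta) *
    expect P (fun w => monomial L w * Y (size L) w ^+ e) =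
  theta * kappa e * expect P (monomial L) +
  \sum_(i < size L) expect P (fun w => monomial L w * Y i w ^+ e).

Let Phi L := expect P (monomial L).

Lemma urn_moment0 : Phi [::] = 1. Proof. exact: expect_cst. Qed.

Lemma urn_momentS e L : ((size L)%:R + theta) * Phi (e :: L) =
  theta * kappa e * Phi L + \sum_(i < size L) Phi (add_at L i e).
Proof.
have -> : Phi (e :: L) = expect P (fun w => monomial L w * Y (size L) w ^+ e).
  by congr expect; apply/funext => w /=; rewrite mulrC.
rewrite urn; congr (_ + _); rewrite (reindex_inj rev_ord_inj)/=.
apply: eq_bigr => i _; congr expect; apply/funext => w.
by rewrite monomial_add_at// mulrC.
Qed.

Context (mf : Omega -> R) (c0 : R).
Hypothesis bmf : bmeas mf.
Hypothesis Y_mf : {ae P, forall w,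
  (c0 + \sum_(i < n) Y i w) / (n%:R + theta) @[n --> \oo] --> mf w}.


(** The average has the form of a predictive mean, with prior mass [theta], since the convergence
    comes from the predictive distributions. *)
Let avg n w := (c0 + \sum_(i < n) Y i w) / (n%:R + theta).

Let nt0 (n : nat) : 0 < n%:R + theta. Proof. by rewrite ltr_wpDl. Qed.

Let bavg n : bmeas (avg n).
Proof.
rewrite /avg; under eq_fun do rewrite mulrC.
by apply/bmeasZ/bmeasD; [exact: bmeas_cst|exact: bmeas_sum].
Qed.

Let avg_le n w : `|avg n w| <= `|c0| / theta + `|M|.
Proof.
rewrite normrM normfV (gtr0_norm (nt0 n)) ler_pdivrMr//.
rewrite (le_trans (ler_normD _ _))// mulrDl lerD//.
  rewrite -mulrA ler_peMr// mulrC ler_pdivlMr// mul1r lerDr.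
  by rewrite ler0n.
rewrite (le_trans (ler_norm_sum _ _ _))// (@le_trans _ _ (\sum_(i < n) `|M|))//.
  by apply: ler_sum => i _; rewrite (le_trans (YM _ _))// ler_norm.
by rewrite sumr_const card_ord -[X in X <= _]mulr_natr ler_wpM2l// lerDl ltW.
Qed.

(** Induction on [j]: one factor [mf] is the limit of [avg], and the expectation of [U] times [Y i]
    is the same number [b] for all [i >= size L]. Indeed the induction hypothesis turns it into a
    value of [Phi], which is invariant under permutations. The finitely many smaller [i] vanish in
    the mean. *)
Lemma urn_limit_monomial j L :
  expect P (fun w => monomial L w * mf w ^+ j) = Phi (nseq j 1%N ++ L).
Proof.
elim: j L => [|j IHj] L.
  by congr expect; apply/funext => w; rewrite expr0 mulr1.
pose U w := monomial L w * mf w ^+ j.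
have bU : bmeas U by apply: bmeasM; [exact: bmeas_monomial|exact: bmeasX].
have [N N0 UN] := bmeasP bU.
have cv1 : expect P (fun w => U w * avg n w) @[n --> \oo] -->
           expect P (fun w => U w * mf w).
  apply: (expect_dominated (M := N * (`|c0| / theta + `|M|))).
  - by move=> n; exact: bmeasM.
  - exact: bmeasM.
  - by move=> n; apply: aeW => w; rewrite normrM ler_pM.
  - by apply: filterS Y_mf => w Yw; exact: cvgMr.
have -> : expect P (fun w => monomial L w * mf w ^+ j.+1) = expect P (fun w => U w * mf w).
  by congr expect; apply/funext => w; rewrite /U exprSr mulrA.
set b := Phi _.
have UYE i : (size L <= i)%N -> expect P (fun w => U w * Y i w) = b.
  (* The zeros place the exponent 1 at the head exactly on variable [i]. *)
  move=> Li; pose L' := (1%N :: nseq (i - size L) 0%N ++ L).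
  rewrite (_ : (fun _ => _) = fun w => monomial L' w * mf w ^+ j); last first.
    apply/funext => w; rewrite /L' /= monomial_nseq0 size_cat size_nseq subnK//.
    by rewrite /U expr1; ring.
  rewrite IHj /b /Phi /L'.
  (* The same zeros are put on the other side, as only lists of equal length can be permutations of
     each other. *)
  have -> : expect P (monomial (nseq j.+1 1%N ++ L)) =
      expect P (monomial (nseq (i - size L) 0%N ++ nseq j.+1 1%N ++ L)).
    by congr expect; apply/funext => w; rewrite monomial_nseq0.
  apply: (urn_moment_perm theta0 urn_momentS).
  apply/permP => p; rewrite !count_cat /= !count_cat !count_nseq /=; lia.
(* With this [a], the expectation of [U] times [avg n] is exactly (a + n b) / (n + theta) once
   [n >= size L]. *)
pose a := c0 * expect P U + \sum_(i < size L) expect P (fun w => U w * Y i w) -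
          (size L)%:R * b.
have cv2 : expect P (fun w => U w * avg n w) @[n --> \oo] --> b.
  have := @cvg_affine_ratio R a b theta theta0; apply: cvg_trans; apply: near_eq_cvg.
  near=> n.
  have Ln : (size L <= n)%N by near: n; exact: nbhs_infty_ge.
  have -> : (fun w => U w * avg n w) =
      (fun w => (n%:R + theta)^-1 * (c0 * U w + \sum_(i < n) U w * Y i w)).
    by apply/funext => w; rewrite /avg -mulr_sumr; ring.
  rewrite expectZ; last first.
    by apply: bmeasD; [exact: bmeasZ|apply: bmeas_sum => i; exact: bmeasM].
  rewrite expectD; [|exact: bmeasZ|by apply: bmeas_sum => i; exact: bmeasM].
  rewrite expectZ// expect_sum; last by move=> i; exact: bmeasM.
  rewrite [RHS]mulrC; congr (_ / _).
  rewrite -(big_mkord xpredT (fun i => expect P (fun w => U w * Y i w))).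
  rewrite (big_cat_nat (leq0n _) Ln)//= big_mkord.
  rewrite (eq_big_nat _ _ (F2 := fun=> b)); last first.
    by move=> i /andP[Li _]; exact: UYE.
  by rewrite sumr_const_nat mulrnBr// /a; ring.
exact: (cvg_unique _ cv1 cv2).
Unshelve. all: by end_near. Qed.

Lemma urn_limit_moment m : expect P (fun w => mf w ^+ m) = Phi (nseq m 1%N).
Proof.
rewrite -[nseq m 1%N]cats0 -urn_limit_monomial.
by congr expect; apply/funext => w; rewrite mul1r.
Qed.

End urn_limit.

(** * The urn of a sequence in the class L *)

Lemma measurable_eval_pprob (R : realType) (d d' : measure_display)
    (T : measurableType d) (S : measurableType d') (p : T -> pprobability S R)
    (A : set S) : measurable_fun setT p -> measurable A ->
  measurable_fun setT (fun x => p x A).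
Proof. by move=> mp mA; exact: (measurable_kernel (kprobability mp) A mA). Qed.

Section random_probability.
Context (R : realType) (d d' : measure_display) (T : measurableType d)
  (S : measurableType d').

Definition pr (p : probability S R) (A : set S) : R := fine (p A).

Lemma prE (p : probability S R) A : measurable A -> (pr p A)%:E = p A.
Proof. by move=> mA; rewrite /pr fineK// fin_num_measure. Qed.

Lemma pr_ge0 (p : probability S R) A : 0 <= pr p A.
Proof. by rewrite fine_ge0. Qed.

Lemma pr_le1 (p : probability S R) A : measurable A -> pr p A <= 1.
Proof. by move=> mA; rewrite -lee_fin prE// probability_le1. Qed.

Lemma bmeas_pr (p : T -> pprobability S R) A : measurable_fun setT p ->
  measurable A -> bmeas (fun x => pr (p x) A).
Proof.
move=> mp mA; split; last by exists 1 => x; rewrite ger0_norm ?pr_ge0// pr_le1.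
apply: (@measurableT_comp _ _ _ _ _ _ fine); first exact: fine_measurable.
exact: measurable_eval_pprob.
Qed.

End random_probability.

Lemma ae_integral_eq0 (R : realType) (d : measure_display) (T : measurableType d)
    (P : probability T R) (D : set T) (f : T -> \bar R) : measurable D ->
  measurable_fun D f -> (forall x, D x -> 0 <= f x)%E ->
  (\int[P]_(x in D) f x = 0)%E -> {ae P, forall x, D x -> f x = 0%E}.
Proof.
move=> mD mf f0 If0; apply: (ae_eq_integral_abs P mD mf).1.
by rewrite -[RHS]If0; apply: eq_integral => x /set_mem Dx; rewrite gee0_abs// f0.
Qed.

Lemma ae_comp (R : realType) (d d' : measure_display) (T : measurableType d)
    (T' : measurableType d') (P : probability T R) (Q : probability T' R)
    (Y : T -> T') (E : set T') : measurable_fun setT Y ->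
  (forall A, measurable A -> P (Y @^-1` A) = Q A) ->
  {ae Q, forall y, E y} -> {ae P, forall x, E (Y x)}.
Proof.
move=> mY PQ [N [mN QN NE]]; exists (Y @^-1` N); split.
- by rewrite -[X in measurable X]setTI; exact: mY.
- by rewrite PQ.
- by move=> x /= nE; exact: NE.
Qed.

Lemma expect_law (R : realType) (d d' : measure_display) (T : measurableType d)
    (T' : measurableType d') (P : probability T R) (Q : probability T' R)
    (Y : T -> T') (f : T' -> R) : measurable_fun setT Y ->
  (forall A, measurable A -> P (Y @^-1` A) = Q A) -> bmeas f ->
  expect P (fun x => f (Y x)) = expect Q f.
Proof.
move=> mY PQ bf.
apply: (bounded_linear_eq (bounded_linear_expect1 P mY)
  (bounded_linear_expect1 Q (@measurable_id _ _ setT)) _ bf) => A mA.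
rewrite (_ : (fun x => \1_A (Y x)) = \1_(Y @^-1` A))// !expect_indic ?PQ//.
by rewrite -[X in measurable X]setTI; exact: mY.
Qed.

(** * A regular conditional distribution on its own sigma-field *)

Section regular_conditional.
Context (R : realType) (d : measure_display) (S : measurableType d)
  (nu : probability S R) (G : set (set S)) (K : S -> pprobability S R).
Hypotheses (sG : sub_sigma_field G) (mK : measurable_fun setT K)
  (rK : regular_cond_distribution nu G K).

Let sigmaC A : G A -> G (~` A).
Proof. by move=> GA; rewrite -setTD; have [_ + _] := sG.1; exact. Qed.

Let sigmaT : G setT.
Proof. by rewrite -setC0; apply: sigmaC; have [] := sG.1. Qed.

(** The integral of K(x)(A) over the complement of [A], which lies in [G], is nu of the empty set;
    hence K(x)(A) = 0 almost everywhere off [A]. The same for the complement gives K(x)(A) = 1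
    almost everywhere on [A]. *)
Lemma kernel_indic A : G A -> {ae nu, forall x, pr (K x) A = \1_A x}.
Proof.
move=> GA; have mA : measurable A := sG.2 _ GA.
have GC := sigmaC GA.
have mC : measurable (~` A) := sG.2 _ GC.
have zero B : G (~` B) -> measurable B -> measurable (~` B) ->
    {ae nu, forall x, (~` B) x -> K x B = 0%E}.
  move=> GB mB mBC; apply: ae_integral_eq0 => //.
    by apply: measurable_funTS; exact: measurable_eval_pprob.
  by rewrite -rK.2// setICr measure0.
have h1 := zero A GC mA mC.
have h2 : {ae nu, forall x, A x -> K x (~` A) = 0%E}.
  by have := zero (~` A); rewrite setCK; exact.
move: h1 h2; apply: filterS2 => x h1 h2; rewrite indicE.
have [/set_mem Ax|/negP xA] := boolP (x \in A).
  apply: EFin_inj; rewrite prE//.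
  have := probability_setC (K x) mC; rewrite setCK h2// => ->.
  by rewrite sube0.
by apply: EFin_inj; rewrite prE// h1// => Ax; apply: xA; rewrite inE.
Qed.

Lemma kernel_mean A : measurable A -> expect nu (fun x => pr (K x) A) = pr nu A.
Proof.
move=> mA; apply: EFin_inj; rewrite prE//.
have := rK.2 A setT mA sigmaT; rewrite setIT => ->.
rewrite /expect /Rintegral fineK; last first.
  by apply: integrable_fin_num => //; exact: (bmeas_integrable nu (bmeas_pr mK mA)).
by apply: eq_integral => x _; rewrite prE.
Qed.

End regular_conditional.

(** * From predictive distributions to the urn identity *)

Section class_L_urn.
Context (R : realType) (dO dS : measure_display) (Omega : measurableType dO)
  (S : measurableType dS) (P : probability Omega R) (X : nat -> {RV P >-> S})
  (nu : probability S R) (theta : R) (K : {mfun S >-> pprobability S R})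
  (G : set (set S)).
Hypotheses (theta0 : 0 < theta) (sG : sub_sigma_field G)
  (rK : regular_cond_distribution nu G K)
  (X0 : forall A, measurable A -> P (X 0%N @^-1` A) = nu A)
  (Xpred : forall n A, (0 < n)%N -> measurable A ->
     cond_prob_version P (past X n) (X n @^-1` A) (predictive nu theta K X n A)).

Let mX i : measurable_fun setT (X i) := measurable_funP (X i).
Let mK : measurable_fun setT K := measurable_funP K.

Let mXpre i A : measurable A -> measurable (X i @^-1` A).
Proof. by move=> mA; rewrite -[X in measurable X]setTI; exact: mX. Qed.

Let nt0 (n : nat) : 0 < n%:R + theta. Proof. by rewrite ltr_wpDl. Qed.

Let bK i A : measurable A -> bmeas (fun w => pr (K (X i w)) A).
Proof. by move=> mA; exact: (bmeas_comp (mX i) (bmeas_pr mK mA)). Qed.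

Definition rpredictive n A w : R :=
  (theta * pr nu A + \sum_(i < n) pr (K (X i w)) A) / (n%:R + theta).

Lemma predictiveE n A w : measurable A ->
  predictive nu theta K X n A w = (rpredictive n A w)%:E.
Proof.
move=> mA; rewrite /predictive /rpredictive EFinM EFinD EFinM prE// -sumEFin.
by congr ((_ + _) * _)%E; apply: eq_bigr => i _; rewrite prE.
Qed.

Definition past_gen n : set (set Omega) :=
  \bigcup_(i in `I_n) preimage_set_system setT (X i) measurable.

Lemma past_measurable n B : past X n B -> measurable B.
Proof.
apply: smallest_sub; first exact: sigma_algebra_measurable.
by move=> _ [i _ [A mA <-]]; exact: mX.
Qed.

Lemma expect_predictive n A B : (0 < n)%N -> measurable A -> past X n B ->
  (n%:R + theta) * expect P (fun w => \1_B w * \1_A (X n w)) =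
  theta * pr nu A * expect P \1_B +
  \sum_(i < n) expect P (fun w => \1_B w * pr (K (X i w)) A).
Proof.
move=> n0 mA pB; have mB := past_measurable pB.
have bB : bmeas (\1_B : Omega -> R) := bmeas_indic R mB.
have -> : expect P (fun w => \1_B w * \1_A (X n w)) =
    expect P (fun w => \1_B w * rpredictive n A w).
  rewrite (_ : (fun w => _ * \1_A _) = \1_(X n @^-1` A `&` B)); last first.
    by apply/funext => w; rewrite setIC indicI.
  rewrite expect_indic; last by apply: measurableI => //; exact: mXpre.
  have [_ ->//] := Xpred n0 mA.
  rewrite /expect /Rintegral [in LHS]integral_mkcond; congr fine.
  apply: eq_integral => w _; rewrite patchE indicE predictiveE//.
  by case: (w \in B); rewrite ?mul1r ?mul0r.
rewrite (_ : (fun w => _) = fun w => (n%:R + theta)^-1 *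
    (theta * pr nu A * \1_B w + \sum_(i < n) \1_B w * pr (K (X i w)) A)); last first.
  by apply/funext => w; rewrite /rpredictive -mulr_sumr; ring.
have bBK i : bmeas (fun w => \1_B w * pr (K (X i w)) A).
  by apply: bmeasM => //; exact: bK.
have bs : bmeas (fun w => \sum_(i < n) \1_B w * pr (K (X i w)) A) by exact: bmeas_sum.
rewrite expectZ; last by apply: bmeasD => //; exact: bmeasZ.
rewrite mulrA divff ?gt_eqF// mul1r expect_linear//.
by rewrite expect_sum.
Qed.

(** Strong induction, with the whole space as past event: since [K] averages to [nu] under [nu], the
    prior term and each earlier variable contribute multiples of nu(A) with total weight n + theta.
    The lemma transports [nu]-null sets through every [X i]. *)
Lemma X_law n A : measurable A -> P (X n @^-1` A) = nu A.
Proof.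
move: A; elim/ltn_ind: n => -[_ |n IHn] A mA; first exact: X0.
have pT : past X n.+1 setT.
  rewrite -setC0 -setTD; apply: sigma_algebraCD; exact: sigma_algebra0.
have := expect_predictive (ltn0Sn n) mA pT.
have indT : (fun=> 1) = (\1_setT : Omega -> R) by apply/funext => w; rewrite indicT.
rewrite -indT expect_cst mulr1.
under [X in _ * expect P X]eq_fun do rewrite mul1r.
rewrite (eq_bigr (fun=> pr nu A)); last first.
  move=> i _; under eq_fun do rewrite mul1r.
  by rewrite (expect_law (mX i) (IHn i (ltn_ord i)) (bmeas_pr mK mA)) (kernel_mean sG).
rewrite sumr_const card_ord (_ : _ + _ = (n.+1%:R + theta) * pr nu A); last by ring.
move=> /(mulfI (lt0r_neq0 (nt0 n.+1))).
rewrite (_ : (fun w => \1_A _) = \1_(X n.+1 @^-1` A))// expect_indic; last exact: mXpre.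
move=> h; rewrite -[RHS]prE// -h fineK//.
by apply: fin_num_measure; exact: mXpre.
Qed.

(** Two extensions by linearity, first in [g] and then in [U], reduce the claim to indicators of a
    set of [G] and of an event of the past. There [kernel_indic] replaces K(X_i)(A) by 1_A(X_i),
    which turns the predictive rule into an urn; this is why [g] has to be measurable for [G]. *)
Lemma expect_urn n (g : g_sigma_algebraType G -> R)
    (U : g_sigma_algebraType (past_gen n) -> R) : (0 < n)%N ->
  bmeas g -> bmeas U ->
  (n%:R + theta) * expect P (fun w => U w * g (X n w)) =
  theta * expect nu g * expect P U + \sum_(i < n) expect P (fun w => U w * g (X i w)).
Proof.
move=> n0 bg bU.
have GE : (measurable : set (set (g_sigma_algebraType G))) = G.
  exact: (measurable_g_measurableTypeE sG.1).
have mXG i : measurable_fun setT (X i : Omega -> g_sigma_algebraType G).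
  by move=> _ A; rewrite GE => GA; apply: mX => //; exact: sG.2.
have mid : measurable_fun setT (id : Omega -> g_sigma_algebraType (past_gen n)).
  by move=> _ B pB; rewrite setTI; exact: past_measurable pB.
have midG : measurable_fun setT (id : S -> g_sigma_algebraType G).
  by move=> _ A; rewrite GE setTI => GA; exact: sG.2.
have bUO : bmeas (U : Omega -> R) := bmeas_comp mid bU.
refine (@bounded_linear_eq R _ (g_sigma_algebraType G)
  (fun g => (n%:R + theta) * expect P (fun w => U w * g (X n w)))
  (fun g => theta * expect nu g * expect P U +
     \sum_(i < n) expect P (fun w => U w * g (X i w))) _ _ _ g bg).
- by apply: bounded_linearZ; exact: (bounded_linear_expect P (mXG n) bUO).
- apply: bounded_linearD; last first.
    by apply: bounded_linear_sum => i; exact: (bounded_linear_expect P (mXG i) bUO).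
  under eq_fun do rewrite mulrAC.
  by apply: bounded_linearZ; exact: (bounded_linear_expect1 nu midG).
move=> A; rewrite GE => GA; have mA := sG.2 _ GA.
have b1 i : bmeas (fun w => \1_A (X i w) : R).
  exact: (bmeas_comp (mX i) (bmeas_indic R mA)).
have comm i : bounded_linear (fun V : g_sigma_algebraType (past_gen n) -> R =>
    expect P (fun w => V w * \1_A (X i w))).
  rewrite (_ : (fun V : g_sigma_algebraType (past_gen n) -> R => _) =
    fun V : g_sigma_algebraType (past_gen n) -> R =>
      expect P (fun w => \1_A (X i w) * V w)).
    exact: (bounded_linear_expect P mid (b1 i)).
  by apply/funext => V; congr expect; apply/funext => w; rewrite mulrC.
refine (@bounded_linear_eq R _ (g_sigma_algebraType (past_gen n))
  (fun U => (n%:R + theta) * expect P (fun w => U w * \1_A (X n w)))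
  (fun U => theta * expect nu \1_A * expect P U +
     \sum_(i < n) expect P (fun w => U w * \1_A (X i w))) _ _ _ U bU).
- by apply: bounded_linearZ; exact: comm.
- apply: bounded_linearD.
    by apply: bounded_linearZ; exact: (bounded_linear_expect1 P mid).
  by apply: bounded_linear_sum => i; exact: comm.
move=> B pB; rewrite (expect_predictive n0 mA pB) (expect_indic nu mA); congr (_ + _).
have bB := bmeas_indic R (past_measurable pB).
apply: eq_bigr => i _; apply: expect_ae_eq.
- by apply: bmeasM => //; exact: bK.
- exact: bmeasM.
(* The exceptional set belongs to this [A] alone; its preimage under [X i] is null because [X i] has
   law [nu]. *)
have := ae_comp (mX i) (X_law i) (kernel_indic sG mK rK GA).
by apply: filterS => w /= ->.
Qed.

End class_L_urn.

Section finite_combinations.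
Context (R : realType) (d d' : measure_display) (T : measurableType d)
  (S : measurableType d').

Definition comb (s : seq (R * set S)) (p : probability S R) : R :=
  \sum_(a <- s) a.1 * pr p a.2.

Lemma bmeas_comb s (p : T -> pprobability S R) : measurable_fun setT p ->
  (forall a, a \in s -> measurable a.2) -> bmeas (fun x => comb s (p x)).
Proof.
move=> mp ms; rewrite /comb; elim: s ms => [|a s IHs] ms.
  by under eq_fun do rewrite big_nil; exact: bmeas_cst.
under eq_fun do rewrite big_cons.
apply: bmeasD; last by apply: IHs => b bs; apply: ms; rewrite in_cons bs orbT.
by apply: bmeasZ; apply: bmeas_pr => //; apply: ms; rewrite mem_head.
Qed.

End finite_combinations.

Section class_L_moments.
Context (R : realType) (dO dS : measure_display) (Omega : measurableType dO)
  (S : measurableType dS) (P : probability Omega R) (X : nat -> {RV P >-> S})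
  (nu : probability S R) (theta : R) (K : {mfun S >-> pprobability S R})
  (mu : {mfun Omega >-> pprobability S R}).
Hypotheses (hX : class_L X nu theta K) (hmu : predictive_limit X mu).

(** The existential [Phi] hides the variables: the comparison with stick-breaking uses the recursion
    alone. *)
Lemma class_L_mean_moment (s : seq (R * set S)) :
  (forall a, a \in s -> measurable a.2) ->
  let kappa e := expect nu (fun x => comb s (K x) ^+ e) in
  exists Phi : seq nat -> R, [/\ Phi [::] = 1,
    forall e L, ((size L)%:R + theta) * Phi (e :: L) =
      theta * kappa e * Phi L + \sum_(i < size L) Phi (add_at L i e) &
    forall m, expect P (fun w => comb s (mu w) ^+ m) = Phi (nseq m 1%N)].
Proof.
move=> ms kappa; have [theta0 [G sG rK] X0 Xpred] := hX.
have mXi i : measurable_fun setT (X i) := measurable_funP (X i).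
pose f (x : S) : R := comb s (K x).
(* Measurability for the smaller sigma-field [G], which the urn identity demands; it comes from the
   regularity of [K]. *)
have bf : bmeas (f : g_sigma_algebraType G -> R).
  rewrite /f /comb; elim: s ms {kappa f} => [|a s IHs] ms.
    by under eq_fun do rewrite big_nil; exact: bmeas_cst.
  under eq_fun do rewrite big_cons.
  apply: bmeasD; last by apply: IHs => b bs; apply: ms; rewrite in_cons bs orbT.
  have ma : measurable a.2 by apply: ms; rewrite mem_head.
  apply: bmeasZ; split; last by exists 1 => x; rewrite ger0_norm ?pr_ge0// pr_le1.
  apply: (@measurableT_comp _ _ _ _ _ _ fine); first exact: fine_measurable.
  exact: rK.1.
have bfS : bmeas f by apply: bmeas_comb => //; exact: measurable_funP.
have [M fM] := bfS.2.
pose Y i w := f (X i w).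
have mY i : measurable_fun setT (Y i) := (bmeas_comp (mXi i) bfS).1.
have YM i w : `|Y i w| <= M by exact: fM.
have past_mono L n : (size L <= n)%N ->
    bmeas (monomial Y L : g_sigma_algebraType (past_gen X n) -> R).
  elim: L => [|e L IHL] /= Ln; first exact: bmeas_cst.
  apply: bmeasM; last by apply: IHL; exact: ltnW.
  apply: bmeasX.
  apply: (@bmeas_comp _ _ _ (g_sigma_algebraType (past_gen X n)) _ f (X (size L))) => //.
  by move=> _ A mA; apply: sub_sigma_algebra; exists (size L) => //; exists A.
have urn e L : ((size L)%:R + theta) *
    expect P (fun w => monomial Y L w * Y (size L) w ^+ e) =
    theta * kappa e * expect P (monomial Y L) +
    \sum_(i < size L) expect P (fun w => monomial Y L w * Y i w ^+ e).
  (* The predictive rule starts at n = 1; for the empty past the urn rule says that the first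
     variable has law [nu]. *)
  have [->|L0] := eqVneq L [::].
    rewrite /= big_ord0 addr0 add0r expect_cst mulr1; congr (_ * _).
    under eq_fun do rewrite mul1r.
    exact: (expect_law (mXi 0%N) X0 (bmeasX e bfS)).
  apply: (expect_urn theta0 sG rK X0 Xpred (g := fun x => f x ^+ e)) => //.
  - by rewrite lt0n size_eq0.
  - exact: (@bmeasX _ _ (g_sigma_algebraType G)).
  - exact: past_mono.
pose c0 := theta * comb s nu.
have bmf : bmeas (fun w => comb s (mu w)) by apply: bmeas_comb => //; exact: measurable_funP.
have Y_mf : {ae P, forall w,
    (c0 + \sum_(i < n) Y i w) / (n%:R + theta) @[n --> \oo] --> comb s (mu w)}.
  have Ypred n w : (c0 + \sum_(i < n) Y i w) / (n%:R + theta) =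
      \sum_(a <- s) a.1 * rpredictive X nu theta K n a.2 w.
    rewrite /c0 /Y /f /comb /rpredictive exchange_big mulr_sumr -big_split mulr_suml.
    by apply: eq_bigr => a _ /=; rewrite -mulr_sumr; ring.
  under eq_near do under eq_cvg do rewrite Ypred.
  have : {ae P, forall w, forall a, a \in s ->
      rpredictive X nu theta K n a.2 w @[n --> \oo] --> pr (mu w) a.2}.
    elim: s ms {kappa f bf bfS M fM Y mY YM past_mono urn c0 bmf Ypred} => [|a s IHs] ms.
      exact: aeW.
    have ma : measurable a.2 by apply: ms; rewrite mem_head.
    (* The explicit predictive probabilities are themselves versions of the conditional ones, so the
       assumed limit applies to them. *)
    have h1 := hmu ma (fun n n0 => Xpred n a.2 n0 ma).
    have h2 := IHs (fun b bs => ms b (mem_behead (s := a :: s) bs)).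
    move: h1 h2; apply: filterS2 => w h1 h2 b; rewrite in_cons => /orP[/eqP->|]; last exact: h2.
    have h1' : (rpredictive X nu theta K n a.2 w)%:E @[n --> \oo] --> (pr (mu w) a.2)%:E.
      rewrite prE//; apply: cvg_trans h1; apply: near_eq_cvg; apply: nearW => n.
      by rewrite predictiveE.
    exact: (fine_cvg h1').
  apply: filterS => w h; rewrite /comb.
  by apply: cvg_sumr => a sa; apply: cvgMr; exact: h.
exists (fun L => expect P (monomial Y L)); split.
- exact: urn_moment0.
- exact: (urn_momentS urn).
- exact: (urn_limit_moment mY YM theta0 urn bmf Y_mf).
Qed.

End class_L_moments.

(** * Stick-breaking *)

Section independence_expectation.
Context (R : realType) (d : measure_display) (T : measurableType d)
  (P : probability T R).

(** Independence is given for events and passes to functions one variable at a time. Hence the mixed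
    form [H], with functions on [s1] and indicators on [s2]: an index moves from [s1] to [s2] when
    its function is reduced to an indicator. *)
Lemma mutually_indep_expect (d' : measure_display) (T' : measurableType d')
    (Y : nat -> {RV P >-> T'}) (s : seq nat) (phi : nat -> T' -> R) :
  mutually_indep Y -> uniq s -> (forall j, bmeas (phi j)) ->
  expect P (fun w => \prod_(j <- s) phi j (Y j w)) =
  \prod_(j <- s) expect P (fun w => phi j (Y j w)).
Proof.
move=> iY us bphi; have mY j : measurable_fun setT (Y j) := measurable_funP (Y j).
have mYpre j A : measurable A -> measurable (Y j @^-1` A).
  by move=> mA; rewrite -[X in measurable X]setTI; exact: mY.
have indE j (A : set T') : (fun w => \1_A (Y j w)) = \1_(Y j @^-1` A) :> (T -> R) by [].
suff H s1 s2 (A : nat -> set T') : uniq (s1 ++ s2) -> (forall j, measurable (A j)) ->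
    expect P (fun w => \prod_(j <- s1) phi j (Y j w) * \prod_(j <- s2) \1_(A j) (Y j w)) =
    \prod_(j <- s1) expect P (fun w => phi j (Y j w)) *
    \prod_(j <- s2) expect P (fun w => \1_(A j) (Y j w)).
  have := H s [::] (fun=> set0); rewrite cats0 !big_nil mulr1 => <- //.
  by congr expect; apply/funext => w; rewrite big_nil mulr1.
elim: s1 s2 A => [|a s1 IHs] s2 A us12 mA.
  rewrite big_nil mul1r.
  rewrite (_ : (fun w => _) = \1_(\big[setI/setT]_(j <- s2) (Y j @^-1` A j))); last first.
    apply/funext => w; rewrite big_nil mul1r.
    elim: s2 {us12} => [|j s2 IH2]; first by rewrite !big_nil indicT.
    by rewrite !big_cons indicI IH2.
  rewrite expect_indic; last by elim/big_ind: _ => // *; [exact: measurableI|exact: mYpre].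
  rewrite iY//; elim: s2 {us12} => [|j s2 IH2]; first by rewrite !big_nil.
  rewrite !big_cons fineM ?IH2 ?indE ?expect_indic//; [exact: mYpre| |].
    by apply: fin_num_measure; exact: mYpre.
  by elim/big_ind: _ => // *; [exact: fin_numM|by apply: fin_num_measure; exact: mYpre].
pose U w := \prod_(j <- s1) phi j (Y j w) * \prod_(j <- s2) \1_(A j) (Y j w) : R.
have bU : bmeas U.
  apply: bmeasM; apply: bmeas_prod => j; first exact: bmeas_comp.
  by apply: (bmeas_comp (mY j)); exact: bmeas_indic.
pose c := \prod_(j <- s1) expect P (fun w => phi j (Y j w)) *
    \prod_(j <- s2) expect P (fun w => \1_(A j) (Y j w)).
rewrite big_cons.
rewrite (_ : (fun w => _) = fun w => U w * phi a (Y a w)); last first.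
  by apply/funext => w; rewrite /U big_cons; ring.
transitivity (c * expect P (fun w => phi a (Y a w))); last by rewrite /c; ring.
apply: (bounded_linear_eq (bounded_linear_expect P (mY a) bU)
  (bounded_linearZ c (bounded_linear_expect1 P (mY a))) _ (bphi a)) => B mB.
(* As [a] is not in [s2], assigning it the event [B] leaves the other indicators unchanged. *)
pose A' j := if j == a then B else A j.
move: us12; rewrite /= mem_cat negb_or => /andP[/andP[as1 as2] us12].
have AA' w : \prod_(j <- s2) \1_(A j) (Y j w) = \prod_(j <- s2) \1_(A' j) (Y j w) :> R.
  apply: eq_big_seq => j js2; rewrite /A'; case: eqP => // ja.
  by rewrite -ja js2 in as2.
have := IHs (a :: s2) A'; rewrite big_cons {1 3}/A' eqxx.
have -> : \prod_(j <- s2) expect P (fun w => \1_(A' j) (Y j w)) =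
    \prod_(j <- s2) expect P (fun w => \1_(A j) (Y j w)).
  apply: eq_big_seq => j js2; rewrite /A'; case: eqP => // ja.
  by rewrite -ja js2 in as2.
move=> H; rewrite /c -mulrA [_ * expect _ _]mulrC -H.
- congr expect; apply/funext => w; rewrite /U big_cons AA' {2}/A' eqxx; ring.
- rewrite -cat1s (perm_uniq (permEl (perm_catCA s1 [:: a] s2))) /=.
  by rewrite mem_cat negb_or as1 as2.
- by move=> j; rewrite /A'; case: ifP.
Qed.

Lemma indep_sigma_expect (F H : set (set T)) (u : g_sigma_algebraType F -> R)
    (v : g_sigma_algebraType H -> R) :
  <<s F >> `<=` measurable -> <<s H >> `<=` measurable ->
  indep_sigma P <<s F >> <<s H >> -> bmeas u -> bmeas v ->
  expect P (fun w => u w * v w) = expect P u * expect P v.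
Proof.
move=> FT HT FH bu bv.
have midF : measurable_fun setT (id : T -> g_sigma_algebraType F).
  by move=> _ B pB; rewrite setTI; exact: FT.
have midH : measurable_fun setT (id : T -> g_sigma_algebraType H).
  by move=> _ B pB; rewrite setTI; exact: HT.
have buT : bmeas (u : T -> R) := bmeas_comp midF bu.
refine (@bounded_linear_eq R _ (g_sigma_algebraType H)
  (fun v => expect P (fun w => u w * v w)) (fun v => expect P u * expect P v)
  _ _ _ v bv).
- exact: (bounded_linear_expect P midH buT).
- by apply: bounded_linearZ; exact: (bounded_linear_expect1 P midH).
move=> B HB.
rewrite (_ : (fun w => _) = fun w => \1_B w * u w); last by apply/funext => w; rewrite mulrC.
rewrite mulrC.
have bB : bmeas (\1_B : T -> R) by apply: bmeas_indic; exact: HT.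
refine (@bounded_linear_eq R _ (g_sigma_algebraType F)
  (fun u => expect P (fun w => \1_B w * u w)) (fun u => expect P \1_B * expect P u)
  _ _ _ u bu).
- exact: (bounded_linear_expect P midF bB).
- by apply: bounded_linearZ; exact: (bounded_linear_expect1 P midF).
move=> A FA.
rewrite (_ : (fun w => _) = \1_(A `&` B)); last first.
  by apply/funext => w; rewrite indicI mulrC.
have mA := FT _ FA; have mB := HT _ HB.
rewrite !expect_indic//; last exact: measurableI.
by rewrite FH// fineM ?fin_num_measure// mulrC.
Qed.

End independence_expectation.

(** * Moments of truncated stick-breaking sums *)

Section stick_moments.
Context (R : realType) (d : measure_display) (T : measurableType d)
  (P : probability T R) (u : nat -> T -> R) (b : nat -> nat -> R) (kappa : nat -> R).

(* For sticks [T j = W j * prod_(i < j) (1 - W i)], this is the expectation of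
   [prod_(j < n) (T j * y j) ^+ a_j * prod_(j < n) (1 - W j) ^+ m], where the
   exponents [a_j] are listed in [A] from the last one down to the first. *)
Fixpoint stick_weight (A : seq nat) (m : nat) : R :=
  if A is a :: A' then b a m * kappa a * stick_weight A' (a + m) else 1.

Hypothesis bu : forall j, bmeas (u j).
Hypothesis uE : forall A, expect P (monomial u A) = stick_weight A 0.

(** The m-th moment of a sum of [n] sticks with their atoms: of the [m] factors, [k] fall on the
    first stick and the others share the power (1 - W)^(m - k). The empty sum gives 0^m, with 0^0 =
    1. *)
Fixpoint stick_moment (n m : nat) : R :=
  if n is n'.+1 then
    \sum_(k < m.+1) 'C(m, k)%:R * kappa k * b k (m - k) * stick_moment n' (m - k)
  else (m == 0%N)%:R.

Let bu_monomial A : bmeas (monomial u A).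
Proof.
elim: A => [|a A IHA] /=; first exact: bmeas_cst.
by apply: bmeasM => //; exact: bmeasX.
Qed.

(** Induction on [n]: the binomial formula peels off the next stick, whose power [k] joins the
    monomial. By definition [stick_weight (k :: A) (m - k)] is [b k (m - k) * kappa k] times
    [stick_weight A m], so the weight of [A] factors out; the later sticks are never divided by 1 -
    W. *)
Lemma expect_stick_monomial A n m :
  expect P (fun w => monomial u A w * (\sum_(j < n) u (size A + j)%N w) ^+ m) =
  stick_weight A m * stick_moment n m.
Proof.
elim: n A m => [|n IHn] A m.
  under eq_fun do rewrite big_ord0 expr0n.
  case: m => [|m] /=; last first.
    by under eq_fun do rewrite mulr0; rewrite expect_cst mulr0.
  by under eq_fun do rewrite mulr1; rewrite uE mulr1.
rewrite (_ : (fun w => _) = fun w => \sum_(k < m.+1) 'C(m, k)%:R *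
    (monomial u (nat_of_ord k :: A) w *
     (\sum_(j < n) u (size (nat_of_ord k :: A) + j)%N w) ^+ (m - k))).
  have bt k : bmeas (fun w => monomial u (k :: A) w *
      (\sum_(j < n) u (size (k :: A) + j)%N w) ^+ (m - k)).
    by apply: bmeasM; [exact: (bu_monomial (k :: A))|apply/bmeasX/bmeas_sum].
  rewrite expect_sum; last by move=> k; apply: bmeasZ; exact: bt.
  rewrite [stick_moment _ _]/= mulr_sumr; apply: eq_bigr => k _.
  rewrite expectZ; last exact: bt.
  rewrite IHn /= subnKC; last by rewrite -ltnS.
  by ring.
apply/funext => w; rewrite big_ord_recl addn0 addrC exprDn mulr_sumr.
apply: eq_bigr => k _; rewrite /= -mulr_natl.
under eq_bigr do rewrite /bump /= add1n addnS -addSn.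
by ring.
Qed.

Lemma expect_stick_sum n m :
  expect P (fun w => (\sum_(j < n) u j w) ^+ m) = stick_moment n m.
Proof.
have := expect_stick_monomial [::] n m; rewrite /= mul1r => <-.
by congr expect; apply/funext => w; rewrite mul1r.
Qed.

(** The moments of the truncated sums converge by dominated convergence, so the recursion from [n]
    to [n.+1] sticks becomes an identity between the limits. *)
Lemma stick_limit_rec (ms : T -> R) (M : R) : bmeas ms ->
  (forall n, {ae P, forall w, `|\sum_(j < n) u j w| <= M}) ->
  {ae P, forall w, \sum_(j < n) u j w @[n --> \oo] --> ms w} ->
  forall m, expect P (fun w => ms w ^+ m) = \sum_(k < m.+1)
    'C(m, k)%:R * kappa k * b k (m - k) * expect P (fun w => ms w ^+ (m - k)).
Proof.
move=> bms uM u_ms.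
have cv m : stick_moment n m @[n --> \oo] --> expect P (fun w => ms w ^+ m).
  under eq_cvg do rewrite -expect_stick_sum.
  apply: (expect_dominated (M := M ^+ m)).
  - by move=> n; apply/bmeasX/bmeas_sum.
  - exact: bmeasX.
  - by move=> n; apply: filterS (uM n) => w uMw; rewrite normrX lerXn2r ?nnegrE// (le_trans _ uMw).
  - apply: filterS u_ms => w uw.
    by apply: (cvg_comp _ (fun x => x ^+ m) uw); exact: exprn_continuous.
move=> m; have := cv m; rewrite -cvg_shiftS => cv1.
apply: (cvg_unique _ cv1) => //=.
by apply: cvg_sumr => k _; apply: cvgMr; exact: cv.
Qed.

End stick_moments.

(** * Mixed moments of the law beta(1, theta) *)

Section onem_powR_integral.
Context (R : realType).
Local Notation mu := (@lebesgue_measure R).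

Lemma is_derive_onem_powR (a x : R) : x < 1 ->
  is_derive x 1 (fun y => (1 - y) `^ a) (- (a * (1 - x) `^ (a - 1))).
Proof.
move=> x1; have y0 : 0 < 1 - x by rewrite subr_gt0.
have d1 := is_derive1_powR a y0.
have d2 : is_derive x 1 (fun y : R => 1 - y) (-1).
  by apply: is_derive_eq; ring.
have := @is_derive1_comp R (fun z => z `^ a) (fun y => 1 - y) x _ _ d1 d2.
by rewrite mulrN1.
Qed.

Lemma continuous_onem_powR (a x : R) : x < 1 ->
  {for x, continuous (fun y : R => (1 - y) `^ a)}.
Proof.
move=> x1; apply: differentiable_continuous; apply/derivable1_diffP.
by have [] := is_derive_onem_powR a x1.
Qed.

Lemma measurable_onem_powR (a : R) :
  measurable_fun setT (fun x : R => (1 - x) `^ a).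
Proof.
apply: (@measurableT_comp _ _ _ _ _ _ (fun y : R => y `^ a)).
  exact: measurable_powR.
exact: measurable_funB.
Qed.

(** For a < 1 the integrand is unbounded near 1, so the primitive is used on [[0, c n]] with [c n]
    increasing to 1, followed by monotone convergence. *)
Lemma integral_onem_powR (a : R) : 0 < a ->
  (\int[mu]_(x in `]0%R, 1%R[) ((1 - x) `^ (a - 1))%:E = (a^-1)%:E)%E.
Proof.
move=> a0.
have mf D : measurable_fun D (fun x : R => ((1 - x) `^ (a - 1))%:E).
  by apply/measurable_EFinP; apply: measurable_funTS; exact: measurable_onem_powR.
rewrite integral_itv_obnd_cbnd; last exact: mf.
(* The shift by 2 keeps [c n] strictly positive from n = 0 on. *)
pose c (n : nat) : R := 1 - n.+2%:R^-1.
have c1 n : c n < 1 by rewrite /c ltrBlDr ltrDl invr_gt0.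
have c0 n : 0 < c n by rewrite /c subr_gt0 invf_lt1// ltr1n.
have -> : `[0%R, 1%R[%classic = \bigcup_n `[0%R, c n]%classic.
  apply/seteqP; split => x /=.
    rewrite in_itv/= => /andP[x0 x1].
    have y0 : 0 < 1 - x by rewrite subr_gt0.
    have [n _ /(_ n (leqnn _)) h] := near_infty_natSinv_lt (PosNum y0).
    exists n => //=; rewrite in_itv/= x0 /= /c lerBrDl addrC -lerBrDl.
    by rewrite (le_trans _ (ltW h))// lef_pV2 ?posrE// ler_nat.
  by move=> [n _] /=; rewrite !in_itv/= => /andP[-> h]/=; exact: le_lt_trans (c1 n).
pose F x := - ((1 - x) `^ a / a).
have dF (x : R) : x < 1 -> is_derive x 1 F ((1 - x) `^ (a - 1)).
  move=> x1; have := is_derive_onem_powR a x1 => d1.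
  have -> : F = (- a^-1) \*: (fun y => (1 - y) `^ a).
    by apply/funext => y; rewrite -[RHS]/(- a^-1 * (1 - y) `^ a) /F; ring.
  apply: (is_derive_eq (is_deriveZ (- a^-1) d1)).
  rewrite -[LHS]/(- a^-1 * - (a * (1 - x) `^ (a - 1))); field.
  by rewrite gt_eqF.
have int n : (\int[mu]_(x in `[0%R, c n]) ((1 - x) `^ (a - 1))%:E =
    ((1 - n.+2%:R^-1 `^ a) / a)%:E)%E.
  rewrite (@continuous_FTC2 _ _ F)//=.
  - rewrite -EFinB /F /c subr0 powR1; congr EFin.
    by rewrite subKr; field; rewrite gt_eqF.
  - apply: continuous_in_subspaceT => x; rewrite inE/= in_itv/= => /andP[_ xc].
    by apply: continuous_onem_powR; rewrite (le_lt_trans xc).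
  - have cF (x : R) : x < 1 -> F y @[y --> x] --> F x.
      move=> x1; apply: differentiable_continuous; apply/derivable1_diffP.
      by have [] := dF x x1.
    split.
    + move=> x; rewrite in_itv/= => /andP[_ xc].
      by have [] := dF x (lt_trans xc (c1 n)).
    + by apply: cvg_at_right_filter; exact: cF.
    + by apply: cvg_at_left_filter; exact: cF.
  - move=> x; rewrite in_itv/= => /andP[_ xc].
    by rewrite derive1E; have [_ ->] := dF x (lt_trans xc (c1 n)).
have cv1 : (\int[mu]_(x in `[0%R, c n]) ((1 - x) `^ (a - 1))%:E)%E @[n --> \oo] -->
    (\int[mu]_(x in \bigcup_n `[0%R, c n]%classic) ((1 - x) `^ (a - 1))%:E)%E.
  apply: ge0_nondecreasing_set_cvg_integral => //.
  - move=> m n mn; rewrite subsetEset => x /=; rewrite !in_itv/= => /andP[-> h] /=.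
    by rewrite (le_trans h)// /c lerD2l lerN2 lef_pV2 ?posrE// ler_nat.
  - by move=> n; exact: mf.
  - by move=> n x _; rewrite lee_fin powR_ge0.
have cv2 : (\int[mu]_(x in `[0%R, c n]) ((1 - x) `^ (a - 1))%:E)%E @[n --> \oo] --> (a^-1)%:E.
  under eq_cvg do rewrite int.
  apply: cvg_EFin; first exact: nearW.
  rewrite [X in _ --> X](_ : _ = (1 - 0) / a); last by rewrite subr0 mul1r.
  apply: cvgMl; apply: cvgB; first exact: cvg_cst.
  apply: (cvg_at_rightP (fun x => x `^ a) 0 0).1 (powR_cvg0 a0) _ _; split=> [n|].
    by rewrite invr_gt0.
  by have := @cvg_harmonic R; rewrite -cvg_shiftS.
exact: (cvg_unique _ cv1 cv2).
Qed.

End onem_powR_integral.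

Section beta_moments.
Context (R : realType) (theta : R).
Hypothesis theta0 : 0 < theta.
Local Notation mu := (@lebesgue_measure R).
Local Notation D := (`]0%R, 1%R[%classic : set R).

(** Sticks lie in [0, 1] only almost surely; clipped, they are bounded everywhere, as [bmeas]
    requires. *)
Definition clip (x : R) : R := Num.max 0 (Num.min 1 x).

Lemma clip_itv x : 0 <= clip x <= 1.
Proof. by rewrite /clip le_max lexx /= ge_max ler01 /= ge_min lexx. Qed.

Lemma clip_id x : 0 <= x <= 1 -> clip x = x.
Proof. by move=> /andP[x0 x1]; rewrite /clip min_r// max_r. Qed.

Lemma bmeas_clip : bmeas clip.
Proof.
split; last first.
  by exists 1 => x; case/andP: (clip_itv x) => c0 c1; rewrite ger0_norm.
apply: measurable_maxr; first exact: measurable_cst.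
by apply: measurable_minr; [exact: measurable_cst|exact: measurable_id].
Qed.

Let q (x : R) : R := theta * (1 - x) `^ (theta - 1).

Let beta_pdfE x : real_beta_pdf 1 theta x = q x.
Proof.
have wE y : beta_weight 1 theta y = (1 - y) `^ (theta - 1).
  by rewrite /beta_weight subrr powRr0 mul1r.
rewrite /real_beta_pdf /real_beta_fun /Rintegral wE.
under eq_integral do rewrite wE.
by rewrite integral_onem_powR//= invrK mulrC.
Qed.

Let q0 x : 0 <= q x. Proof. by rewrite mulr_ge0 ?powR_ge0 ?ltW. Qed.

Let mq (E : set R) : measurable_fun E q.
Proof.
apply: measurable_funTS; apply: measurable_funM; first exact: measurable_cst.
exact: measurable_onem_powR.
Qed.

Let int_q : (\int[mu]_(x in D) (q x)%:E = 1)%E.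
Proof.
under eq_integral do rewrite EFinM.
rewrite ge0_integralZl//.
- by rewrite integral_onem_powR// -EFinM divff// gt_eqF.
- by apply/measurable_EFinP; apply: measurable_funTS; exact: measurable_onem_powR.
- by move=> x _; rewrite lee_fin powR_ge0.
- by rewrite lee_fin ltW.
Qed.

Let integrable_q : mu.-integrable D (EFin \o q).
Proof.
apply/integrableP; split; first by apply/measurable_EFinP; exact: mq.
under eq_integral do rewrite /= ger0_norm//.
by rewrite int_q ltry.
Qed.

Let integrable_bq (h : R -> R) : bmeas h -> mu.-integrable D (EFin \o (fun x => h x * q x)).
Proof.
move=> bh; have [M M0 hM] := bmeasP bh.
rewrite (_ : _ \o _ = (EFin \o h) \* (EFin \o q))%E; last first.
  by apply/funext => x /=; rewrite EFinM.
apply: integrableMr => //; first by apply: measurable_funTS; exact: bh.1.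
by exists M; split; rewrite ?num_real// => N MN x _; rewrite /= (le_trans (hM x))// ltW.
Qed.

Lemma beta_expect (d : measure_display) (T : measurableType d) (P : probability T R)
    (W : {RV P >-> R}) (h : R -> R) : beta_distributed 1 theta W -> bmeas h ->
  expect P (fun w => h (W w)) = \int[mu]_(x in D) (h x * q x).
Proof.
move=> bW bh; have mW : measurable_fun setT W := measurable_funP W.
apply: (bounded_linear_eq (L2 := fun h => \int[mu]_(x in D) (h x * q x))
  (bounded_linear_expect1 P mW) _ _ bh).
  split=> [a f g bf bg|].
    have ih := integrable_bq bf.
    have iaf : mu.-integrable D (EFin \o (fun x => a * (f x * q x))).
      rewrite (_ : (fun x => _) = fun x => (a * f x) * q x); last first.
        by apply/funext => x; rewrite mulrA.
      by apply: integrable_bq; exact: bmeasZ.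
    transitivity (\int[mu]_(x in D) (a * (f x * q x) + g x * q x)).
      by apply: eq_Rintegral => x _; ring.
    by rewrite (RintegralD _ iaf (integrable_bq bg))// RintegralZl.
  exists 1 => f M bf fM; rewrite mul1r.
  have M0 : 0 <= M by exact: le_trans (fM 0).
  apply: (le_trans (le_normr_Rintegral _ (integrable_bq bf))) => //.
  have -> : M = \int[mu]_(x in D) (M * q x).
    by rewrite RintegralZl// /Rintegral int_q mulr1.
  apply: le_Rintegral => //.
  - have := integrable_abse (integrable_bq bf).
    by apply: eq_integrable => // x _.
  - by apply: (integrable_bq (bmeas_cst _ M)).
  - by move=> x _; rewrite normrM (ger0_norm (q0 x)) ler_wpM2r.
move=> A mA; rewrite (_ : (fun w => _) = \1_(W @^-1` A))// expect_indic; last first.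
  by rewrite -[X in measurable X]setTI; exact: mW.
rewrite bW//.
under eq_integral do rewrite beta_pdfE.
rewrite -/(Rintegral mu (A `&` D) q) Rintegral_mkcondl.
apply: eq_Rintegral => x _; rewrite patchE indicE.
by case: (x \in A); rewrite ?mul1r ?mul0r.
Qed.

(** Induction on [k], from W^(k+1) (1 - W)^l = W^k (1 - W)^l - W^k (1 - W)^(l+1): only powers of 1 -
    W have to be integrated. *)
Lemma beta_clip_moment (d : measure_display) (T : measurableType d) (P : probability T R)
    (W : {RV P >-> R}) k l : beta_distributed 1 theta W ->
  expect P (fun w => clip (W w) ^+ k * (1 - clip (W w)) ^+ l) = beta_moment theta k l.
Proof.
move=> bW; have mW : measurable_fun setT W := measurable_funP W.
have bc : bmeas (fun w => clip (W w)) := bmeas_comp mW bmeas_clip.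
have bt k' l' : bmeas (fun w => clip (W w) ^+ k' * (1 - clip (W w)) ^+ l').
  by apply: bmeasM; apply: bmeasX => //; apply: bmeasB => //; exact: bmeas_cst.
elim: k l => [|k IHk] l.
  rewrite /beta_moment fact0 big_ord1 addn0 mulr1.
  have tl0 : 0 < theta + l%:R by rewrite ltr_pwDl.
  have bh : bmeas (fun x => clip x ^+ 0 * (1 - clip x) ^+ l).
    by apply: bmeasM; apply: bmeasX; rewrite ?subr0; [exact: bmeas_clip|
      apply: bmeasB; [exact: bmeas_cst|exact: bmeas_clip]].
  rewrite (beta_expect bW bh).
  transitivity (\int[mu]_(x in D) (theta * (1 - x) `^ (theta + l%:R - 1))).
    apply: eq_Rintegral => x; rewrite inE/= in_itv/= => /andP[x0 x1].
    have y0 : 0 < 1 - x by rewrite subr_gt0.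
    rewrite clip_id ?(ltW x0) ?(ltW x1)// expr0 mul1r /q mulrCA; congr (_ * _).
    rewrite -powR_mulrn ?ltW// -powRD; last by apply/implyP => _; rewrite gt_eqF.
    by congr powR; ring.
  rewrite /Rintegral; under eq_integral do rewrite EFinM.
  rewrite ge0_integralZl//.
  - by rewrite integral_onem_powR.
  - by apply/measurable_EFinP; apply: measurable_funTS; exact: measurable_onem_powR.
  - by move=> x _; rewrite lee_fin powR_ge0.
  - by rewrite lee_fin ltW.
have -> : expect P (fun w => clip (W w) ^+ k.+1 * (1 - clip (W w)) ^+ l) =
    expect P (fun w => clip (W w) ^+ k * (1 - clip (W w)) ^+ l) -
    expect P (fun w => clip (W w) ^+ k * (1 - clip (W w)) ^+ l.+1).
  by rewrite -expectB//; congr expect; apply/funext => w; rewrite !exprS; ring.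
rewrite !IHk /beta_moment factS natrM.
have t0 (i : nat) : theta + i%:R != 0 by rewrite gt_eqF// ltr_pwDl.
rewrite [X in _ / X - _]big_ord_recl addn0.
rewrite [X in _ - _ / X]big_ord_recr.
rewrite [X in _ = _ / X]big_ord_recl addn0 big_ord_recr /=.
have pE : \prod_(i < k) (theta + (l + bump 0 i)%:R) = \prod_(i < k) (theta + (l.+1 + i)%:R) :> R.
  by apply: eq_bigr => i _; rewrite /bump /= add1n addnS addSn.
rewrite pE (_ : bump 0 k = k.+1)// addnS addSn.
set p := \prod_(i < k) _.
have p0 : p != 0 by apply/prodf_neq0 => i _; exact: t0.
have := t0 l; have := t0 (l + k).+1; rewrite -[(l + k).+1]addn1 !natrD -(natr1 k).
move: (l%:R) (k%:R) => x y h1 h2; field.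
by rewrite h1 p0 h2.
Qed.

End beta_moments.

(** * Monomials in the sticks *)

Section monomial_products.
Context (R : realType) (d : measure_display) (T : measurableType d).

Lemma monomialE (Y : nat -> T -> R) A w :
  monomial Y A w = \prod_(j < size A) Y j w ^+ nth 0%N (rev A) j.
Proof.
elim: A => [|a A IHA]; first by rewrite big_ord0.
rewrite /= big_ord_recr /= rev_cons nth_rcons size_rev ltnn eqxx mulrC IHA.
congr (_ * _); apply: eq_bigr => j _.
by rewrite nth_rcons size_rev ltn_ord.
Qed.

Lemma monomialM (Y Y' : nat -> T -> R) A w :
  monomial (fun j w => Y j w * Y' j w) A w = monomial Y A w * monomial Y' A w.
Proof. by elim: A => [|a A IHA] /=; rewrite ?mulr1// IHA exprMn; ring. Qed.

(** Share of the variable W_j in a monomial of sticks: W_j enters its own stick, and 1 - W_j enters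
    every later one. The argument [m] accumulates the exponents of the later sticks. *)
Fixpoint stick_factor (A : seq nat) (m j : nat) (x : R) : R :=
  if A is a :: A' then
    if j == size A' then x ^+ a * (1 - x) ^+ m else stick_factor A' (a + m) j x
  else 1.

Lemma monomial_sticks (c : nat -> T -> R) A m w :
  monomial (sticks c) A w * (\prod_(i < size A) (1 - c i w)) ^+ m =
  \prod_(j < size A) stick_factor A m j (c j w).
Proof.
elim: A m => [|a A IHA] m; first by rewrite !big_ord0 expr1n mulr1.
rewrite /= !big_ord_recr /= eqxx.
rewrite [X in _ = X * _](eq_bigr (fun j : 'I_(size A) => stick_factor A (a + m) j (c j w))).
  by rewrite -IHA /sticks !exprMn exprD; ring.
by move=> j _; rewrite ltn_eqF.
Qed.

End monomial_products.

(** Isolates the contribution of the atoms, to match the independence of atoms and weights. *)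
Lemma stick_weight_split (R : realType) (b : nat -> nat -> R) kappa A m :
  stick_weight b kappa A m = stick_weight b (fun=> 1) A m * \prod_(a <- A) kappa a.
Proof.
elim: A m => [|a A IHA] m /=; first by rewrite big_nil mulr1.
by rewrite IHA big_cons; ring.
Qed.

Section stick_breaking_moments.
Context (R : realType) (d : measure_display) (T : measurableType d)
  (P : probability T R) (theta : R) (W : nat -> {RV P >-> R}).
Hypotheses (theta0 : 0 < theta) (iW : iid W) (bW : beta_distributed 1 theta (W 0%N)).

Let bWj j : beta_distributed 1 theta (W j).
Proof. by move=> A mA; rewrite iW.2// bW. Qed.

Let c j w := clip (W j w).

Let bmeas_factor A m j : bmeas (fun x => stick_factor A m j (clip x) : R).
Proof.
elim: A m => [|a A IHA] m /=; first exact: bmeas_cst.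
case: (j == size A) => //; apply: bmeasM; apply: bmeasX; first exact: bmeas_clip.
by apply: bmeasB; [exact: bmeas_cst|exact: bmeas_clip].
Qed.

Lemma expect_monomial_sticks A :
  expect P (monomial (sticks c) A) = stick_weight (beta_moment theta) (fun=> 1) A 0.
Proof.
rewrite (_ : monomial _ _ = fun w => \prod_(j < size A) stick_factor A 0 j (c j w)); last first.
  by apply/funext => w; rewrite -monomial_sticks expr0 mulr1.
suff H m : expect P (fun w => \prod_(j < size A) stick_factor A m j (c j w)) =
    stick_weight (beta_moment theta) (fun=> 1) A m by exact: H.
under eq_fun do rewrite -(big_mkord xpredT (fun j => stick_factor A m j (c j _))).
rewrite (mutually_indep_expect iW.1 _ (bmeas_factor A m)); last exact: iota_uniq.
rewrite -/(index_iota 0 (size A)) big_mkord.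
elim: A m => [|a A IHA] m; first by rewrite big_ord0.
rewrite big_ord_recr /= eqxx mulrC mulr1 (beta_clip_moment theta0)//; congr (_ * _).
by rewrite -IHA; apply: eq_bigr => j _; rewrite ltn_eqF.
Qed.

Lemma ae_stick_itv : {ae P, forall w, forall j, 0 <= W j w <= 1}.
Proof.
apply/ae_foralln => j.
have mC : measurable (~` `]0%R, 1%R[%classic : set R) by exact: measurableC.
exists (W j @^-1` (~` `]0%R, 1%R[%classic)); split.
- rewrite -[X in measurable X]setTI; exact: measurable_funP.
- by have := bWj j mC; rewrite setICl integral_set0.
- move=> w /= h; rewrite in_itv/= => /andP[h1 h2]; apply: h.
  by rewrite !ltW.
Qed.

Lemma sticks_itv (u : nat -> R) j : (forall i, 0 <= u i <= 1) ->
  0 <= u j * \prod_(i < j) (1 - u i) <= 1.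
Proof.
move=> u01; have [u0 u1] := andP (u01 j).
have h : 0 <= \prod_(i < j) (1 - u i) <= 1.
  elim/big_ind: _ => [|x y /andP[x0 x1] /andP[y0 y1]|i _]; first by rewrite ler01 lexx.
    by rewrite mulr_ge0//= mulr_ile1.
  by have /andP[? ?] := u01 i; rewrite subr_ge0 gerBl; apply/andP.
by case/andP: h => h0 h1; rewrite mulr_ge0//= mulr_ile1.
Qed.

Lemma ae_sticks_clip : {ae P, forall w, forall j,
  0 <= sticks W j w <= 1 /\ sticks c j w = sticks W j w}.
Proof.
apply: filterS ae_stick_itv => w Ww j; split; first exact: (@sticks_itv (W^~ w)).
rewrite /sticks /c clip_id//; congr (_ * _).
by apply: eq_bigr => i _; rewrite clip_id.
Qed.

End stick_breaking_moments.

Section sequence_laws.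
Context (R : realType).

Definition coord_gen : set (set (nat -> R)) :=
  \bigcup_(j in setT) preimage_set_system setT (fun x => x j) measurable.

Lemma measurable_coord j :
  measurable_fun setT ((fun x => x j) : g_sigma_algebraType coord_gen -> R).
Proof. by move=> _ A mA; apply: sub_sigma_algebra; exists j => //; exists A. Qed.

Lemma measurable_seq (d : measure_display) (T : measurableType d) (Y : nat -> T -> R) :
  (forall j, measurable_fun setT (Y j)) ->
  measurable_fun setT ((fun w => Y ^~ w) : T -> g_sigma_algebraType coord_gen).
Proof.
move=> mY.
apply: (@measurability _ _ T (g_sigma_algebraType coord_gen) setT (fun w => Y ^~ w)
  coord_gen) => //.
by move=> _ [_ [j _ [A mA <-]] <-]; rewrite !setTI; have := mY j measurableT A mA; rewrite setTI.
Qed.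

Lemma same_seq_law_expect (d1 d2 : measure_display) (T1 : measurableType d1)
    (P1 : probability T1 R) (T2 : measurableType d2) (P2 : probability T2 R)
    (Y1 : nat -> T1 -> R) (Y2 : nat -> T2 -> R) (F : g_sigma_algebraType coord_gen -> R) :
  (forall j, measurable_fun setT (Y1 j)) -> (forall j, measurable_fun setT (Y2 j)) ->
  same_seq_law P1 P2 Y1 Y2 -> bmeas F ->
  expect P1 (fun w => F (Y1 ^~ w)) = expect P2 (fun w => F (Y2 ^~ w)).
Proof.
move=> mY1 mY2 Y12 bF; have m1 := measurable_seq mY1; have m2 := measurable_seq mY2.
apply: (bounded_linear_eq (bounded_linear_expect1 P1 m1) (bounded_linear_expect1 P2 m2) _ bF).
move=> B mB.
rewrite (_ : (fun w => _) = \1_[set w | B (Y1 ^~ w)])//.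
rewrite (_ : (fun w => _ (Y2 ^~ w)) = \1_[set w | B (Y2 ^~ w)])//.
rewrite !expect_indic ?Y12//.
  by rewrite -[X in measurable X]setTI; exact: m2.
by rewrite -[X in measurable X]setTI; exact: m1.
Qed.

End sequence_laws.

(** * The stick-breaking mixture and its moments *)

Section stick_mixture_moments.
Context (R : realType) (dO dS : measure_display) (Omega : measurableType dO)
  (S : measurableType dS) (P : probability Omega R) (nu : probability S R)
  (theta : R) (K : {mfun S >-> pprobability S R}) (Z : nat -> {RV P >-> S})
  (V : nat -> {RV P >-> R}) (mustar : {mfun Omega >-> pprobability S R}).
Hypotheses (theta0 : 0 < theta) (hZV : indep_seq Z V) (hZ : iid Z)
  (hZnu : forall A, measurable A -> P (Z 0%N @^-1` A) = nu A)
  (hV : stick_breaking theta V) (hmustar : stick_mixture V Z K mustar).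

(** [V] shares only its law with actual sticks, which live on another probability space; the bound
    is transferred as an event on sequences. *)
Lemma ae_stick_weights : {ae P, forall w, forall j, 0 <= V j w <= 1}.
Proof.
have [d' [T' [P' [W [iW bW VW]]]]] := hV.
apply/ae_foralln => j; pose B := [set x : nat -> R | x j \in `[0, 1]].
have mB : measurable (B : set (g_sigma_algebraType (@coord_gen R))).
  have := @measurable_coord R j measurableT `[0, 1]%classic (measurable_itv _).
  by rewrite setTI.
have mBC : measurable (~` B : set (g_sigma_algebraType (@coord_gen R))) by exact: measurableC.
have mV := measurable_seq (fun j => measurable_funP (V j)).
exists [set w | (~` B) (V ^~ w)]; split.
- by have := mV measurableT _ mBC; rewrite setTI.
- rewrite [LHS](VW _ mBC); have [N [mN PN NE]] := ae_sticks_clip iW bW.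
  apply/eqP; rewrite -measure_le0 -PN; apply: le_measure; rewrite ?inE//.
    have mT : forall j, measurable_fun setT (sticks W j).
      move=> i; rewrite /sticks; apply: measurable_funM; first exact: measurable_funP.
      apply: measurable_prod => k _; apply: measurable_funB => //.
    have mW := measurable_seq mT.
    by have := mW measurableT _ mBC; rewrite setTI.
  apply: subset_trans NE => w /= h h2; apply: h; rewrite /B /= in_itv /=.
  exact: (h2 j).1.
- by move=> w /= h h2; apply: h; rewrite /B /= in_itv/= in h2.
Qed.

Context (s : seq (R * set S)).
Hypothesis ms : forall a, a \in s -> measurable a.2.

Let f x := comb s (K x).
Let bf : bmeas f. Proof. by apply: bmeas_comb => //; exact: measurable_funP. Qed.
Let kappa e := expect nu (fun x => f x ^+ e).
Let v j w := clip (V j w).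
Let y j w := f (Z j w).
Let u j w := v j w * y j w.

Let bv j : bmeas (v j).
Proof. by apply: bmeas_comp; [exact: measurable_funP|exact: bmeas_clip]. Qed.
Let b_y j : bmeas (y j).
Proof. by apply: bmeas_comp; [exact: measurable_funP|exact: bf]. Qed.

Let expect_monomial_y A : expect P (monomial y A) = \prod_(a <- A) kappa a.
Proof.
rewrite (_ : monomial _ _ = fun w => \prod_(j <- index_iota 0 (size A))
    f (Z j w) ^+ nth 0%N (rev A) j); last first.
  by apply/funext => w; rewrite monomialE big_mkord.
rewrite (@mutually_indep_expect _ _ _ P _ _ Z _ (fun j x => f x ^+ nth 0%N (rev A) j)) //;
  [|exact: hZ.1|exact: iota_uniq|by move=> j; exact: bmeasX].
have -> : \prod_(a <- A) kappa a = \prod_(a <- rev A) kappa a.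
  by apply: perm_big; rewrite perm_sym perm_rev.
rewrite [RHS](big_nth 0%N) size_rev; apply: eq_bigr => j _.
have Zj B : measurable B -> P (Z j @^-1` B) = nu B.
  by move=> mB; rewrite hZ.2// hZnu.
by rewrite (expect_law (measurable_funP (Z j)) Zj (bmeasX _ bf)).
Qed.

Let expect_monomial_v A :
  expect P (monomial v A) = stick_weight (beta_moment theta) (fun=> 1) A 0.
Proof.
have [d' [T' [P' [W [iW bW VW]]]]] := hV.
rewrite -(expect_monomial_sticks theta0 iW bW).
pose F (x : g_sigma_algebraType (@coord_gen R)) : R :=
  monomial (fun j (x : g_sigma_algebraType (@coord_gen R)) => clip (x j)) A x.
have bF : bmeas F.
  rewrite {}/F; elim: A => [|a A IHA] /=; first exact: bmeas_cst.
  apply: bmeasM => //; apply: bmeasX.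
  exact: (bmeas_comp (@measurable_coord R _) (@bmeas_clip R)).
have FE d'' (T'' : measurableType d'') (Y : nat -> T'' -> R) w :
    F (Y ^~ w) = monomial (fun j w => clip (Y j w)) A w.
  by rewrite /F; clear F bF; elim: A => //= a A ->.
have mT j : measurable_fun setT (sticks W j).
  rewrite /sticks; apply: measurable_funM; first exact: measurable_funP.
  by apply: measurable_prod => k _; apply: measurable_funB.
have := same_seq_law_expect (fun j => measurable_funP (V j)) mT VW bF.
rewrite (_ : (fun w => F (V ^~ w)) = monomial v A); last by apply/funext => w; exact: FE.
move=> ->; apply: expect_ae_eq.
- exact: (bmeas_comp (measurable_seq mT) bF).
- have bc j : bmeas (sticks (fun j w => clip (W j w)) j).
    rewrite /sticks; apply: bmeasM.
      by apply: bmeas_comp; [exact: measurable_funP|exact: bmeas_clip].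
    apply: bmeas_prod => i; apply: bmeasB; first exact: bmeas_cst.
    by apply: bmeas_comp; [exact: measurable_funP|exact: bmeas_clip].
  clear F bF FE; elim: A => [|a A IHA] /=; first exact: bmeas_cst.
  by apply: bmeasM => //; exact: bmeasX.
(* Clipping the sticks and building sticks from clipped [W] agree wherever all [W j] lie in
   [0, 1]. *)
apply: filterS (ae_sticks_clip iW bW) => w h; rewrite [LHS]FE.
clear F bF FE; elim: A => //= a A ->; congr (_ ^+ _ * _).
by have [h1 ->] := h (size A); rewrite clip_id.
Qed.

(** The monomial is a product of one in the atoms and one in the weights, each measurable for the
    sigma-field of its own sequence, so the independence of [Z] and [V] applies. *)
Let expect_monomial_u A :
  expect P (monomial u A) = stick_weight (beta_moment theta) kappa A 0.
Proof.
rewrite stick_weight_split -expect_monomial_v -expect_monomial_y mulrC.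
rewrite (_ : monomial u A = fun w => monomial y A w * monomial v A w); last first.
  by apply/funext => w; rewrite monomialM mulrC.
pose genZ := \bigcup_(j in setT) preimage_set_system setT (Z j) measurable.
pose genV := \bigcup_(j in setT) preimage_set_system setT (V j) measurable.
apply: (@indep_sigma_expect _ _ _ P genZ genV).
- apply: smallest_sub; first exact: sigma_algebra_measurable.
  by move=> _ [j _ [B mB <-]]; exact: measurable_funP.
- apply: smallest_sub; first exact: sigma_algebra_measurable.
  by move=> _ [j _ [B mB <-]]; exact: measurable_funP.
- exact: hZV.
- elim: A => [|a A IHA] /=; first exact: bmeas_cst.
  apply: bmeasM => //; apply: bmeasX.
  apply: (@bmeas_comp _ _ _ (g_sigma_algebraType genZ) _ f (Z (size A))) => //.
  by move=> _ B mB; apply: sub_sigma_algebra; exists (size A) => //; exists B.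
- elim: A => [|a A IHA] /=; first exact: bmeas_cst.
  apply: bmeasM => //; apply: bmeasX.
  apply: (@bmeas_comp _ _ _ (g_sigma_algebraType genV) _ (@clip R) (V (size A))) => //.
    by move=> _ B mB; apply: sub_sigma_algebra; exists (size A) => //; exists B.
  exact: bmeas_clip.
Qed.

Let stick_sum_cvg w A : measurable A -> (forall j, 0 <= V j w <= 1) ->
  (mustar w A = \sum_(0 <= j <oo) (V j w)%:E * K (Z j w) A)%E ->
  \sum_(j < n) V j w * pr (K (Z j w)) A @[n --> \oo] --> pr (mustar w) A.
Proof.
move=> mA V01 mwA.
have cv : (\sum_(0 <= j < n) (V j w)%:E * K (Z j w) A)%E @[n --> \oo] -->
    (pr (mustar w) A)%:E.
  rewrite prE// mwA; apply: is_cvg_nneseries => j _ _.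
  by rewrite mule_ge0// lee_fin; case/andP: (V01 j).
have cv2 : (\sum_(j < n) V j w * pr (K (Z j w)) A)%:E @[n --> \oo] --> (pr (mustar w) A)%:E.
  apply: cvg_trans cv; apply: near_eq_cvg; apply: nearW => n.
  by rewrite big_mkord -sumEFin; apply: eq_bigr => j _; rewrite EFinM prE.
exact: (fine_cvg cv2).
Qed.

Lemma stick_mixture_moment_rec m :
  expect P (fun w => comb s (mustar w) ^+ m) =
  \sum_(k < m.+1) 'C(m, k)%:R * expect nu (fun x => comb s (K x) ^+ k) *
    beta_moment theta k (m - k) * expect P (fun w => comb s (mustar w) ^+ (m - k)).
Proof.
have bu j : bmeas (u j) by exact: bmeasM.
have [M fM] := bf.2.
have good : {ae P, forall w, (forall j, 0 <= V j w <= 1) /\ forall A, measurable A ->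
    \sum_(j < n) V j w * pr (K (Z j w)) A @[n --> \oo] --> pr (mustar w) A}.
  move: ae_stick_weights hmustar; apply: filterS2 => w V01 mw; split=> // A mA.
  by apply: stick_sum_cvg => //; exact: mw.
apply: (stick_limit_rec (kappa := kappa) bu expect_monomial_u (M := M)).
- by apply: bmeas_comb => //; exact: measurable_funP.
- move=> n; apply: filterS good => w [V01 cv].
  (* Read at [setT], the mixture says that the weights sum to 1; being nonnegative, they have
     partial sums at most 1, which gives the uniform bound [M]. *)
  have V1 : \sum_(j < n) V j w <= 1.
    have prT (p : probability S R) : pr p setT = 1 by rewrite /pr probability_setT.
    have cv1 : \sum_(j < n) V j w @[n --> \oo] --> (1 : R).
      rewrite -(prT (mustar w)); apply: cvg_trans (cv setT measurableT).
      apply: near_eq_cvg; apply: nearW => k.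
      by apply: eq_bigr => j _; rewrite prT mulr1.
    rewrite -(cvg_lim _ cv1)//.
    apply: (@nondecreasing_cvgn_le _ (fun n => \sum_(j < n) V j w)).
      apply/nondecreasing_seqP => k; rewrite big_ord_recr/= lerDl.
      by case/andP: (V01 k).
    by apply/cvg_ex; eexists; exact: cv1.
  have M0 : 0 <= M by exact: le_trans (fM (Z 0%N w)).
  rewrite (le_trans (ler_norm_sum _ _ _))//.
  apply: (@le_trans _ _ (\sum_(j < n) V j w * M)).
    apply: ler_sum => j _; rewrite /u /v clip_id// normrM.
    by have /andP[V0 _] := V01 j; rewrite ger0_norm// ler_wpM2l// fM.
  by rewrite -mulr_suml ler_piMl.
apply: filterS good => w [V01 cv].
have uE n : \sum_(j < n) u j w =
    \sum_(a <- s) a.1 * (\sum_(j < n) V j w * pr (K (Z j w)) a.2).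
  rewrite /u /v /y /f /comb.
  under eq_bigr do rewrite clip_id// mulr_sumr.
  rewrite exchange_big; apply: eq_bigr => a _ /=; rewrite mulr_sumr.
  by apply: eq_bigr => j _; rewrite mulrCA.
under eq_cvg do rewrite uE.
by apply: cvg_sumr => a sa; apply: cvgMr; apply: cv; exact: ms.
Qed.

End stick_mixture_moments.

(** * Moments determine the law *)

(** A nonzero difference [p] would have the [size p] distinct roots 0, ..., size p - 1, one more
    than its degree. *)
Lemma poly_fun_coef_eq (R : realType) n (c e : nat -> R) :
  (forall t, \sum_(k < n) c k * t ^+ k = \sum_(k < n) e k * t ^+ k) ->
  forall k, (k < n)%N -> c k = e k.
Proof.
move=> ce k kn; pose p := \poly_(i < n) (c i - e i).
have p0 : p = 0.
  apply/eqP; apply: contraT => pn0.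
  have pt t : root p t.
    apply/rootP; rewrite horner_poly.
    under eq_bigr do rewrite mulrBl.
    by rewrite sumrB ce subrr.
  pose rs := [seq i%:R | i <- iota 0 (size p)] : seq R.
  have := @max_poly_roots _ p rs pn0; rewrite size_map size_iota ltnn; apply.
    by apply/allP => t _; exact: pt.
  by rewrite map_inj_uniq ?iota_uniq// => i j /eqP; rewrite eqr_nat => /eqP.
have := coef_poly n (fun i => c i - e i) k; rewrite kn -/p p0 coef0.
by move/esym/subr0_eq.
Qed.

(** * Polynomial approximation of half-lines on [0, 1] *)

Section threshold_polynomials.
Context (R : realType).

(* With [y = (x - r + 1) / 2], the factor [(1 - y ^ n) ^ 2 ^ n] tends to 1 for
   [x < r] and to 0 for [x > r]; the second one corrects the limit at [x = r]. *)
Definition threshold (r x : R) (n : nat) : R :=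
  (1 - ((x - r + 1) / 2) ^+ n) ^+ (2 ^ n) * (1 - (1 - (x - r) ^+ 2) ^+ n).

Lemma threshold_poly r n : exists p : {poly R}, forall x, threshold r x n = p.[x].
Proof.
exists ((1 - (2^-1 *: ('X - r%:P + 1)) ^+ n) ^+ (2 ^ n) * (1 - (1 - ('X - r%:P) ^+ 2) ^+ n)).
by move=> x; rewrite /threshold !(hornerE, horner_exp) (mulrC 2^-1).
Qed.

Let bernoulli (u : R) N : -1 <= u -> 1 + N%:R * u <= (1 + u) ^+ N.
Proof.
move=> u1; elim: N => [|N IHN]; first by rewrite mul0r addr0 expr0.
rewrite exprS (@le_trans _ _ ((1 + u) * (1 + N%:R * u)))//; last first.
  by rewrite ler_wpM2l// -lerBlDl sub0r.
have : 0 <= N%:R * u ^+ 2 by rewrite mulr_ge0 ?sqr_ge0.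
rewrite -natr1; lra.
Qed.

Section itv.
Context (r x : R).
Hypotheses (r01 : 0 <= r <= 1) (x01 : 0 <= x <= 1).

Let y := (x - r + 1) / 2.

Let y01 : 0 <= y <= 1.
Proof.
by case/andP: r01 => ? ?; case/andP: x01 => ? ?; rewrite /y; apply/andP; split; lra.
Qed.

Let yn01 n : 0 <= y ^+ n <= 1.
Proof. by case/andP: y01 => y0 y1; rewrite exprn_ge0//= exprn_ile1. Qed.

Let z01 : 0 <= 1 - (x - r) ^+ 2 <= 1.
Proof.
case/andP: r01 => ? ?; case/andP: x01 => ? ?.
have : 0 <= (1 - (x - r)) * (1 + (x - r)) by rewrite mulr_ge0//; lra.
by rewrite gerBl sqr_ge0 andbT -subr_sqr expr1n.
Qed.

Let z1 n : 0 <= 1 - (1 - (x - r) ^+ 2) ^+ n <= 1.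
Proof.
case/andP: z01 => z0 z1.
by rewrite subr_ge0 exprn_ile1//= gerBl exprn_ge0.
Qed.

Let y1 n : 0 <= (1 - y ^+ n) ^+ (2 ^ n) <= 1.
Proof.
case/andP: (yn01 n) => h0 h1.
by rewrite exprn_ge0 ?subr_ge0//= exprn_ile1 ?subr_ge0// gerBl.
Qed.

Lemma threshold_itv n : 0 <= threshold r x n <= 1.
Proof.
case/andP: (y1 n) => a0 a1; case/andP: (z1 n) => b0 b1.
by rewrite /threshold mulr_ge0//= mulr_ile1.
Qed.

(** The exponents are matched so that 2^n y^n = (2 y)^n with 2 y = 1 + (x - r), and Bernoulli's
    inequality decides on which side of 1 this base lies. *)
Lemma cvg_threshold : threshold r x n @[n --> \oo] --> ((x < r)%R%:R : R).
Proof.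
have [xr|rx|xr] := ltgtP x r; last first.
- rewrite /threshold xr subrr expr0n /= subr0.
  by under eq_cvg do rewrite expr1n subrr mulr0; exact: cvg_cst.
- have y2 : 1 < 2 * y by rewrite /y; lra.
  have y20 : 0 < 2 * y by lra.
  apply: (@squeeze_cvgr _ _ _ _ (fun=> 0) (fun n => (2 * y)^-1 ^+ n)).
  + apply: nearW => n; have /andP[-> _] /= := threshold_itv n.
    case/andP: (z1 n) => b0 b1; case/andP: (y1 n) => a0 a1.
    rewrite /threshold (le_trans (ler_piMr _ b1))// exprVn -[leRHS]mul1r ler_pdivlMr ?exprn_gt0//.
    case/andP: (yn01 n) => h0 h1.
    (* Bernoulli gives (2 y)^n <= (1 + y^n)^(2^n), and the product of the two powers is (1 -
       y^(2n))^(2^n), at most 1. *)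
    rewrite (@le_trans _ _ ((1 - y ^+ n) ^+ (2 ^ n) * (1 + y ^+ n) ^+ (2 ^ n)))//.
      rewrite ler_wpM2l// (le_trans _ (bernoulli _ _))//; last by lra.
      by rewrite natrX -exprMn lerDr.
    rewrite -exprMn exprn_ile1//.
      by rewrite mulr_ge0 ?subr_ge0// addr_ge0.
    by rewrite -subr_sqr expr1n gerBl sqr_ge0.
  + exact: cvg_cst.
  + by apply: cvg_expr; rewrite ger0_norm ?invr_ge0 ?ltW// invf_lt1.
- have c1 : (1 - y ^+ n) ^+ (2 ^ n) @[n --> \oo] --> (1 : R).
    have y2 : 2 * y < 1 by rewrite /y; lra.
    apply: (@squeeze_cvgr _ _ _ _ (fun n => 1 - (2 * y) ^+ n) (fun=> 1)).
    + apply: nearW => n; have /andP[_ ->] := y1 n; rewrite andbT.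
      case/andP: (yn01 n) => h0 h1.
      rewrite (le_trans _ (bernoulli _ _))//; last by lra.
      by rewrite natrX mulrN -exprMn.
    + rewrite -[X in _ --> X]subr0; apply: cvgB; first exact: cvg_cst.
      by apply: cvg_expr; case/andP: y01 => y0 _; rewrite ger0_norm// mulr_ge0.
    + exact: cvg_cst.
  have c2 : 1 - (1 - (x - r) ^+ 2) ^+ n @[n --> \oo] --> (1 : R).
    rewrite -[X in _ --> X]subr0; apply: cvgB; first exact: cvg_cst.
    apply: cvg_expr; case/andP: z01 => z0 _; rewrite ger0_norm//.
    by rewrite gtrBl exprn_even_gt0//= subr_eq0 lt_eqF.
  by rewrite -[X in _ --> X]mulr1; exact: cvgM.
Qed.

End itv.
End threshold_polynomials.

(** * From moments to the law of a random probability *)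

Section laws_of_random_probabilities.
Context (R : realType) (dO dS : measure_display) (Omega : measurableType dO)
  (S : measurableType dS) (P : probability Omega R)
  (q1 q2 : {mfun Omega >-> pprobability S R}).
Local Notation RP := {mfun Omega >-> pprobability S R}.

Hypothesis comb_moments : forall s m, (forall a, a \in s -> measurable a.2) ->
  expect P (fun w => comb s (q1 w) ^+ m) = expect P (fun w => comb s (q2 w) ^+ m).

Let mq (q : RP) : measurable_fun setT q :=
  measurable_funP q.

(* The left-hand side for [(t, A) :: s] and exponent [m.+1] is a polynomial in
   [t], whose coefficient of degree one is the sought moment up to [m.+1]. *)
Lemma mixed_moments (As : seq (set S)) (s : seq (R * set S)) m :
  (forall a, a \in s -> measurable a.2) ->
  (forall A, A \in As -> measurable A) ->
  expect P (fun w => comb s (q1 w) ^+ m * \prod_(A <- As) pr (q1 w) A) =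
  expect P (fun w => comb s (q2 w) ^+ m * \prod_(A <- As) pr (q2 w) A).
Proof.
elim: As s m => [|A As IHAs] s m ms mAs.
  have nilE (q : RP) :
      (fun w => comb s (q w) ^+ m * \prod_(A <- [::]) pr (q w) A) = fun w => comb s (q w) ^+ m.
    by apply/funext => w; rewrite big_nil mulr1.
  by rewrite !nilE comb_moments.
have mA : measurable A by apply: mAs; rewrite mem_head.
have mAs' B : B \in As -> measurable B by move=> BAs; apply: mAs; rewrite in_cons BAs orbT.
pose rest (q : RP) w := \prod_(B <- As) pr (q w) B.
have brest (q : RP) : bmeas (rest q).
  rewrite /rest; elim: As mAs' {IHAs mAs rest} => [|B As IH] mAs.
    by under eq_fun do rewrite big_nil; exact: bmeas_cst.
  under eq_fun do rewrite big_cons.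
  apply: bmeasM; first by apply: bmeas_pr => //; apply: mAs; rewrite mem_head.
  by apply: IH => C CAs; apply: mAs; rewrite in_cons CAs orbT.
pose c (q : RP) k := 'C(m.+1, k)%:R *
  expect P (fun w => comb s (q w) ^+ (m.+1 - k) * pr (q w) A ^+ k * rest q w).
have bc (q : RP) k : bmeas (fun w => comb s (q w) ^+ (m.+1 - k) * pr (q w) A ^+ k * rest q w).
  by do 2 (apply: bmeasM => //); apply: bmeasX; [exact: bmeas_comb|exact: bmeas_pr].
have cE (q : RP) t : \sum_(k < m.+2) c q k * t ^+ k =
    expect P (fun w => comb ((t, A) :: s) (q w) ^+ m.+1 * rest q w).
  rewrite [in RHS](_ : (fun w => _) = fun w => \sum_(k < m.+2) ('C(m.+1, k)%:R * t ^+ k) *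
      (comb s (q w) ^+ (m.+1 - k) * pr (q w) A ^+ k * rest q w)); last first.
    apply/funext => w; rewrite /comb big_cons addrC exprDn mulr_suml.
    by apply: eq_bigr => k _; rewrite exprMn -mulr_natl; ring.
  rewrite expect_sum; last by move=> k; exact: bmeasZ.
  by apply: eq_bigr => k _; rewrite expectZ// /c mulrAC.
have coef1 : c q1 1%N = c q2 1%N.
  apply: (poly_fun_coef_eq (n := m.+2)) => // t; rewrite !cE; apply: IHAs => // a.
  by rewrite in_cons => /orP[/eqP->//|]; exact: ms.
have fin (q : RP) : expect P (fun w => comb s (q w) ^+ m * \prod_(B <- A :: As) pr (q w) B) =
    c q 1%N / m.+1%:R.
  rewrite /c bin1 subn1 mulrAC divff ?pnatr_eq0// mul1r; congr expect.
  by apply/funext => w; rewrite big_cons expr1 mulrA.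
by rewrite !fin coef1.
Qed.

Let indic_lt (r x : R) : R := (x < r)%R%:R.

Let bmeas_indic_lt (q : RP) A r : measurable A -> bmeas (fun w => indic_lt r (pr (q w) A)).
Proof.
move=> mA; have -> : (fun w => indic_lt r (pr (q w) A)) =
    \1_((fun w => pr (q w) A) @^-1` `]-oo, r[%classic).
  apply/funext => w; rewrite /indic_lt indicE; congr (nat_of_bool _)%:R.
  by apply/idP/idP; rewrite inE /= in_itv.
apply: bmeas_indic; rewrite -[X in measurable X]setTI.
exact: ((bmeas_pr (mq q) mA).1 measurableT _ (measurable_itv _)).
Qed.

Let prods (q : RP) (l : seq (set S * R)) (As : seq (set S)) w :=
  \prod_(a <- l) indic_lt a.2 (pr (q w) a.1) * \prod_(A <- As) pr (q w) A.

Let bmeas_prods (q : RP) (l : seq (set S * R)) (As : seq (set S)) :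
  (forall a, a \in l -> measurable a.1) ->
  (forall A, A \in As -> measurable A) -> bmeas (prods q l As).
Proof.
move=> ml mAs; rewrite /prods; apply: bmeasM.
  elim: l ml => [|a l IHl] ml; first by under eq_fun do rewrite big_nil; exact: bmeas_cst.
  under eq_fun do rewrite big_cons.
  apply: bmeasM; first by apply: bmeas_indic_lt; apply: ml; rewrite mem_head.
  by apply: IHl => b bl; apply: ml; rewrite in_cons bl orbT.
elim: As mAs => [|A As IHAs] mAs; first by under eq_fun do rewrite big_nil; exact: bmeas_cst.
under eq_fun do rewrite big_cons.
apply: bmeasM; first by apply: bmeas_pr => //; apply: mAs; rewrite mem_head.
by apply: IHAs => B BAs; apply: mAs; rewrite in_cons BAs orbT.
Qed.

(** Induction on [l], with [As] arbitrary: one indicator is approximated by threshold polynomials in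
    p(A), whose monomial of degree [k] adds [k] copies of [A] to [As]. The polynomials stay in
    [0, 1], so dominated convergence applies. *)
Lemma threshold_moments (l : seq (set S * R)) (As : seq (set S)) :
  (forall a, a \in l -> measurable a.1 /\ 0 <= a.2 <= 1) ->
  (forall A, A \in As -> measurable A) ->
  expect P (prods q1 l As) = expect P (prods q2 l As).
Proof.
elim: l As => [|[A r] l IHl] As ml mAs.
  have ms0 (a : R * set S) : a \in [::] -> measurable a.2 by [].
  have := mixed_moments 0 ms0 mAs.
  have nilE (q : RP) : prods q [::] As = fun w => comb [::] (q w) ^+ 0 * \prod_(A <- As) pr (q w) A.
    by apply/funext => w; rewrite /prods big_nil expr0.
  by rewrite !nilE.
have [mA r01] := ml (A, r) (mem_head _ _).
have ml' a : a \in l -> measurable a.1 /\ 0 <= a.2 <= 1.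
  by move=> al; apply: ml; rewrite in_cons al orbT.
have ml1 a : a \in l -> measurable a.1 by move=> /ml'[].
have brest (q : RP) := bmeas_prods q ml1 mAs.
have consE (q : RP) : prods q ((A, r) :: l) As =
    fun w => prods q l As w * indic_lt r (pr (q w) A).
  by apply/funext => w; rewrite /prods big_cons /=; ring.
have bA (q : RP) : bmeas (fun w => pr (q w) A) := bmeas_pr (mq q) mA.
have bt (q : RP) n : bmeas (fun w => threshold r (pr (q w) A) n).
  have [p pE] := threshold_poly r n; under eq_fun do rewrite pE horner_coef.
  by apply: bmeas_sum => i; apply: bmeasZ; exact: bmeasX.
have cv (q : RP) : expect P (fun w => prods q l As w * threshold r (pr (q w) A) n) @[n --> \oo] -->
    expect P (prods q ((A, r) :: l) As).
  rewrite consE; have [M M0 pM] := bmeasP (brest q).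
  have pr01 w : 0 <= pr (q w) A <= 1 by rewrite pr_ge0 pr_le1.
  apply: (expect_dominated (M := M)).
  - by move=> n; exact: bmeasM.
  - by apply: bmeasM => //; exact: bmeas_indic_lt.
  - move=> n; apply: aeW => w; rewrite normrM -[X in _ <= X]mulr1 ler_pM//.
    by have /andP[t0 t1] := threshold_itv r01 (pr01 w) n; rewrite ger0_norm.
  - apply: aeW => w; apply: cvgMr; exact: cvg_threshold.
have eqn n : expect P (fun w => prods q1 l As w * threshold r (pr (q1 w) A) n) =
    expect P (fun w => prods q2 l As w * threshold r (pr (q2 w) A) n).
  have [p pE] := threshold_poly r n.
  have mk k B : B \in nseq k A ++ As -> measurable B.
    by rewrite mem_cat => /orP[/nseqP[->]|/mAs].
  have expand (q : RP) : expect P (fun w => prods q l As w * threshold r (pr (q w) A) n) =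
      \sum_(k < size p) p`_k * expect P (prods q l (nseq k A ++ As)).
    rewrite (_ : (fun w => _) = fun w => \sum_(k < size p) p`_k * prods q l (nseq k A ++ As) w).
      rewrite expect_sum; last by move=> k; apply: bmeasZ; apply: bmeas_prods => //; exact: mk.
      by apply: eq_bigr => k _; rewrite expectZ//; apply: bmeas_prods => //; exact: mk.
    apply/funext => w; rewrite pE horner_coef mulr_sumr; apply: eq_bigr => k _.
    rewrite /prods big_cat /= big_nseq iter_mulr_1.
    by ring.
  by rewrite !expand; apply: eq_bigr => k _; rewrite IHl//; exact: mk.
have cv2 : expect P (fun w => prods q1 l As w * threshold r (pr (q1 w) A) n) @[n --> \oo] -->
    expect P (prods q2 ((A, r) :: l) As).
  by under eq_cvg do rewrite eqn; exact: cv.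
exact: (cvg_unique _ (cv q1) cv2).
Qed.

(** The finite intersections of generators form a pi-system (concatenation of lists), and the
    probability of such a box is a [threshold_moments] expectation; uniqueness of measures
    concludes. *)
Lemma random_probability_law (C : set (pprobability S R)) : measurable C ->
  P (q1 @^-1` C) = P (q2 @^-1` C).
Proof.
pose box (l : seq (set S * R)) : set (pprobability S R) :=
  [set p | forall a, a \in l -> pr p a.1 < a.2].
(* The generators of the sigma-field have thresholds in [0, 1], the range on which the threshold
   polynomials are controlled. *)
pose ok (l : seq (set S * R)) := forall a, a \in l -> measurable a.1 /\ 0 <= a.2 <= 1.
pose G : set (set (pprobability S R)) := [set box l | l in ok].
have msetE A r : measurable A -> mset A r = [set p : pprobability S R | pr p A < r].
  by move=> mA; apply/seteqP; split => p /=; rewrite /mset /= -prE// lte_fin.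
have Gm : G `<=` measurable.
  move=> _ [l okl <-]; elim: l okl => [|[A r] l IHl] okl.
    by rewrite (_ : box [::] = setT)//; apply/seteqP; split.
  have -> : box ((A, r) :: l) = mset A r `&` box l.
    have [mA _] := okl (A, r) (mem_head _ _).
    rewrite msetE//; apply/seteqP; split => p /=.
      move=> h; split; first exact: (h (A, r) (mem_head _ _)).
      by move=> a al; apply: h; rewrite in_cons al orbT.
    by move=> [h1 h2] a; rewrite in_cons => /orP[/eqP->//|]; exact: h2.
  apply: measurableI; last by apply: IHl => a al; apply: okl; rewrite in_cons al orbT.
  have [mA r01] := okl (A, r) (mem_head _ _).
  by apply: sub_sigma_algebra; exists r => //=; exists A.
have mG : (measurable : set (set (pprobability S R))) = <<s G >>.
  apply/seteqP; split; last by apply: smallest_sub Gm; exact: sigma_algebra_measurable.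
  apply: smallest_sub; first exact: smallest_sigma_algebra.
  move=> _ [r r01 [A mA <-]]; apply: sub_sigma_algebra; exists [:: (A, r)].
    by move=> a; rewrite inE => /eqP ->; split.
  rewrite msetE//; apply/seteqP; split => p /= h; first by exact: (h (A, r) (mem_head _ _)).
  by move=> a; rewrite inE => /eqP ->.
have GI : setI_closed G.
  move=> _ _ [l okl <-] [l' okl' <-]; exists (l ++ l').
    by move=> a; rewrite mem_cat => /orP[/okl|/okl'].
  apply/seteqP; split => p /=.
    by move=> h; split=> a al; apply: h; rewrite mem_cat al ?orbT.
  by move=> [h h'] a; rewrite mem_cat => /orP[/h|/h'].
have GT : G setT by exists [::] => //; apply/seteqP; split.
apply: (measure_unique G (fun=> setT) mG GI _ _ (pushforward P q1) (pushforward P q2)) => //.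
- by rewrite bigcup_const.
- move=> _ [l okl <-]; rewrite /pushforward.
  have mbox (q : RP) : measurable (q @^-1` box l).
    rewrite -[X in measurable X]setTI; apply: mq => //.
    by apply: Gm; exists l.
  have probE (q : RP) : P (q @^-1` box l) = (expect P (prods q l [::]))%:E.
    rewrite -[LHS](prE P (mbox q)); congr EFin.
    transitivity (expect P \1_(q @^-1` box l)); first by rewrite expect_indic.
    congr expect; apply/funext => w; rewrite /prods big_nil mulr1 indicE.
    rewrite big_seq; have [/set_mem h|h] := boolP (w \in _).
      by rewrite big1// => a al; rewrite /indic_lt h.
    have [a al pa] : exists2 a, a \in l & ~~ (pr (q w) a.1 < a.2).
      apply/not_exists2P => ha; move/negP: h; apply; apply/mem_set => a al.
      by have := ha a; case=> // /negP; rewrite negbK.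
    by rewrite -big_seq (big_rem a)//= /indic_lt (negbTE pa) mul0r.
  by apply: etrans (probE q1) _; rewrite threshold_moments//; exact/esym/probE.
- move=> k; rewrite [X in (X < _)%E](_ : _ = 1%E) ?ltry//.
  exact: (probability_setT P).
Qed.

End laws_of_random_probabilities.

Theorem theorem9 (R : realType) (dO dS : measure_display)
    (Omega : measurableType dO) (P : probability Omega R)
    (S : measurableType dS) (hS : borel_subset_of_polish R S)
    (X : nat -> {RV P >-> S}) (nu : probability S R) (theta : R)
    (K : {mfun S >-> pprobability S R}) (hX : class_L X nu theta K)
    (mu : {mfun Omega >-> pprobability S R})
    (hemp : empirical_limit X mu) (hpred : predictive_limit X mu)
    (Z : nat -> {RV P >-> S}) (V : nat -> {RV P >-> R})
    (hZV : indep_seq Z V)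
    (hZ : iid Z) (hZnu : forall A, measurable A -> P (Z 0%N @^-1` A) = nu A)
    (hV : stick_breaking theta V)
    (mustar : {mfun Omega >-> pprobability S R})
    (hmustar : stick_mixture V Z K mustar) :
  forall C : set (pprobability S R), measurable C ->
    P (mu @^-1` C) = P (mustar @^-1` C).
Proof.
move=> C mC; have [theta0 _ _ _] := hX.
apply: random_probability_law => // s m ms.
have [Phi [Phi0 PhiS PhiE]] := class_L_mean_moment hX hpred ms.
rewrite PhiE; symmetry.
apply: (stick_recursion_unique theta0 Phi0 PhiS
  (N := fun m => expect P (fun w => comb s (mustar w) ^+ m))).
- by under eq_fun do rewrite expr0; rewrite expect_cst.
- by under eq_fun do rewrite expr0; rewrite expect_cst.
- exact: (stick_mixture_moment_rec theta0 hZV hZ hZnu hV hmustar ms).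
Qed.
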